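(* Let $m\geq n$ and let $A,E\in\mathbb{R}^{m,n}$ with $\mathrm{rank}(A)=n$. For a real parameter $h>0$, consider the complex iteration $$\widehat{X}_{k+1}=\tfrac{1}{2}\widehat{X}_k\left(I_n+\left(\widehat{X}_k^T\widehat{X}_k\right)^{-1}\right),\qquad \widehat{X}_0=A+ihE,$$ where $T$ denotes the (non-conjugating) transpose. Then for all sufficiently small $h>0$ all iterates $\widehat{X}_k\in\mathbb{C}^{m,n}$ have full rank $n$. Moreover, (i) $\mathrm{Re}\left(\mathcal{P}(A+ihE)\right)=\lim_{k\to\infty}\mathrm{Re}(\widehat{X}_k)=\mathcal{P}(A)+\mathcal{O}(h^2)$, and (ii) $\mathrm{Im}\left(\mathcal{P}(A+ihE)/h\right)=\lim_{k\to\infty}\mathrm{Im}(\widehat{X}_k/h)=L_{\mathcal{P}}(A,E)+\mathcal{O}(h^2)$.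
   Context: For a full-rank $B\in\mathbb{C}^{m,n}$ ($m\ge n$), $\mathcal{P}(B)$ denotes the unitary polar factor of $B$, i.e. the matrix $Q$ with orthonormal columns in the polar decomposition $B=QP$ with $P$ Hermitian positive definite; equivalently $\mathcal{P}(B)=B(B^HB)^{-1/2}$ with the principal square root. $L_{\mathcal{P}}(A,E)$ denotes the Fréchet derivative of $\mathcal{P}$ at $A$ in direction $E$ (as a map on real matrices). $\mathrm{Re}$, $\mathrm{Im}$ are taken entrywise. A matrix-valued quantity $Q(h)$ satisfies $Q(h)=B+\mathcal{O}(h^2)$ if there is a constant $C$ with $\|Q(h)-B\|_F\le Ch^2$ as $h\to 0$.
   Formalization: For the complex argument B = A+ihE, P(B) is taken as B(B^T B)^{-1/2} (principal root, non-conjugating transpose) rather than the unitary polar factor B(B^H B)^{-1/2}, for which (i) and (ii) fail, e.g. m=n=1, A=E=1. *)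

(* Defs.v *)
From HB Require Import structures.
From mathcomp Require Import all_boot all_order all_algebra.
From mathcomp Require Import all_classical all_reals all_analysis.
From mathcomp Require Import complex.

Set Implicit Arguments.
Unset Strict Implicit.
Unset Printing Implicit Defensive.
Import Order.TTheory GRing.Theory Num.Theory.
Import numFieldNormedType.Exports.
Local Open Scope ring_scope.

Definition pick_mx (F : Type) (m n : nat) (zero : F) (P : 'M[F]_(m, n) -> Prop)
  : 'M[F]_(m, n) :=
  match pselect (exists X, P X) with
  | left h => proj1_sig (cid h)
  | right _ => const_mx zero
  end.

Section Defs.
Variable R : realType.

Definition frob (m n : nat) (M : 'M[R]_(m, n)) : R :=
  Num.sqrt (\sum_(i < m) \sum_(j < n) M i j ^+ 2).

Definition mxRe (m n : nat) (X : 'M[R[i]]_(m, n)) : 'M[R]_(m, n) :=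
  map_mx (@complex.Re R) X.
Definition mxIm (m n : nat) (X : 'M[R[i]]_(m, n)) : 'M[R]_(m, n) :=
  map_mx (@complex.Im R) X.
Definition cplx (m n : nat) (X : 'M[R]_(m, n)) : 'M[R[i]]_(m, n) :=
  map_mx (fun x => (x%:C)%C) X.

(* Real unitary polar factor: Q with Q^T Q = I and A = Q P, P symmetric
   positive definite.  The polar factor P(A) (unique for full-rank A). *)
Definition is_polar_factorR (m n : nat) (A Q : 'M[R]_(m, n)) : Prop :=
  Q^T *m Q = 1%:M /\
  exists P : 'M[R]_n, P^T = P /\
    (forall v : 'cV[R]_n, v != 0 -> 0 < (v^T *m P *m v) ord0 ord0) /\
    A = Q *m P.
Definition polarR (m n : nat) (A : 'M[R]_(m, n)) : 'M[R]_(m, n) :=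
  pick_mx 0 (is_polar_factorR A).

Definition is_principal_sqrt (n : nat) (M S : 'M[R[i]]_n) : Prop :=
  S *m S = M /\ forall z : R[i], eigenvalue S z -> 0 < complex.Re z.
Definition principal_sqrt (n : nat) (M : 'M[R[i]]_n) : 'M[R[i]]_n :=
  pick_mx 0 (is_principal_sqrt M).

(* Complex(-step) extension of the polar factor, B (B^T B)^{-1/2},
   with the NON-conjugating transpose. *)
Definition polarC (m n : nat) (B : 'M[R[i]]_(m, n)) : 'M[R[i]]_(m, n) :=
  B *m invmx (principal_sqrt (B^T *m B)).

Fixpoint newton_iter (m n : nat) (X0 : 'M[R[i]]_(m, n)) (k : nat)
  : 'M[R[i]]_(m, n) :=
  match k with
  | 0 => X0
  | k'.+1 => let X := newton_iter X0 k' in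
             (2^-1 : R[i]) *: (X *m (1%:M + invmx (X^T *m X)))
  end.

Definition cstep (m n : nat) (A E : 'M[R]_(m, n)) (h : R) : 'M[R[i]]_(m, n) :=
  cplx A + ((h *i)%C) *: cplx E.

End Defs.

(* Main.v *)
(* For z = ihE (or a small real perturbation z) the principal square root S of
   (A+z)^T (A+z) exists because 1 - (A+z)^T (A+z) / c^2 is a strict contraction
   for a suitable c: S = c (1 - Y) with Y the fixed point of Y = (K + Y^2)/2.
   This S is accretive, Re <X, S X> >= g <X, X>, which bounds S^-1, gives the
   Sylvester estimate |S X + X T| >= 2 g |X|, and turns the Newton iteration
   X_k = Q S_k into the squaring of a strictly contractive Cayley transform.
   Comparing S with its second order Taylor polynomial in z through the Sylvester
   estimate yields P(A+z) = Q0 + Q1(z) + Q2(z) + O(z^3) with Q1 linear, Q2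
   quadratic and both commuting with complex conjugation.  For real z this is
   differentiability with derivative Q1; for z = ihE the terms are real, purely
   imaginary and real respectively, whence both O(h^2) claims. *)
Require Import Defs.
From HB Require Import structures.
From mathcomp Require Import all_boot all_order all_algebra.
From mathcomp Require Import all_classical all_reals all_analysis.
From mathcomp Require Import complex ring lra.
Import Order.TTheory GRing.Theory Num.Theory.
Import numFieldNormedType.Exports.
Local Open Scope ring_scope.
Local Open Scope classical_set_scope.
Set Implicit Arguments.
Unset Strict Implicit.
Unset Printing Implicit Defensive.

(** * Real inner product and Frobenius norm on complex matrices *)

Section InnerProduct.
Variable R : realType.
Local Notation C := R[i].

Definition conjmatrix m n (X : 'M[C]_(m, n)) : 'M[C]_(m, n) := map_mx (@conjc R) X.
Definition adjmx m n (X : 'M[C]_(m, n)) : 'M[C]_(n, m) := (conjmatrix X)^T.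
(** The Euclidean inner product of the underlying real space of dimension 2mn; taking the real part
    makes it symmetric. [fro] is then the complex Frobenius norm. *)
Definition ip m n (X Y : 'M[C]_(m, n)) : R := complex.Re (\tr (adjmx X *m Y)).
Definition fro m n (X : 'M[C]_(m, n)) : R := Num.sqrt (ip X X).

Lemma ReD (x y : C) : complex.Re (x + y) = complex.Re x + complex.Re y.
Proof. by case: x => a b; case: y. Qed.

Lemma Re_sum (I : Type) (r : seq I) (P : pred I) (F : I -> C) :
  complex.Re (\sum_(i <- r | P i) F i) = \sum_(i <- r | P i) complex.Re (F i).
Proof. by apply: (big_morph _ ReD). Qed.

Lemma ipE m n (X Y : 'M[C]_(m, n)) : ip X Y =
  \sum_i \sum_j (complex.Re (X i j) * complex.Re (Y i j)
                 + complex.Im (X i j) * complex.Im (Y i j)).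
Proof.
rewrite /ip /mxtrace Re_sum exchange_big; apply: eq_bigr => j _.
rewrite !mxE Re_sum; apply: eq_bigr => i _; rewrite !mxE.
by case: (X i j) => a b; case: (Y i j) => c d /=; ring.
Qed.

Lemma adjmxM m n p (X : 'M[C]_(m, n)) (Y : 'M[C]_(n, p)) :
  adjmx (X *m Y) = adjmx Y *m adjmx X.
Proof. by rewrite /adjmx /conjmatrix map_mxM trmx_mul. Qed.

Lemma conjmatrixK m n : involutive (@conjmatrix m n).
Proof. by move=> X; apply/matrixP => i j; rewrite !mxE conjcK. Qed.

Lemma ip_adjl m n p (A : 'M[C]_(m, n)) (X : 'M[C]_(n, p)) Y :
  ip (A *m X) Y = ip X (adjmx A *m Y).
Proof. by rewrite /ip adjmxM mulmxA. Qed.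

Lemma ipC m n (X Y : 'M[C]_(m, n)) : ip X Y = ip Y X.
Proof.
by rewrite !ipE; apply: eq_bigr => i _; apply: eq_bigr => j _; ring.
Qed.

Lemma ip_adj m n (X Y : 'M[C]_(m, n)) : ip (adjmx X) (adjmx Y) = ip X Y.
Proof.
rewrite !ipE exchange_big; apply: eq_bigr => i _; apply: eq_bigr => j _.
by rewrite !mxE; case: (X i j) => a b; case: (Y i j) => c d /=; ring.
Qed.

Lemma ip_conj m n (X Y : 'M[C]_(m, n)) :
  ip (conjmatrix X) (conjmatrix Y) = ip X Y.
Proof.
rewrite !ipE; apply: eq_bigr => i _; apply: eq_bigr => j _.
by rewrite !mxE; case: (X i j) => a b; case: (Y i j) => c d /=; ring.
Qed.

Lemma ipDr m n (X Y Z : 'M[C]_(m, n)) : ip X (Y + Z) = ip X Y + ip X Z.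
Proof. by rewrite /ip mulmxDr mxtraceD ReD. Qed.

Lemma ipNr m n (X Y : 'M[C]_(m, n)) : ip X (- Y) = - ip X Y.
Proof.
by apply/eqP; rewrite -addr_eq0 -ipDr addNr /ip mulmx0 mxtrace0.
Qed.

Lemma ipZr m n (a : R) (X Y : 'M[C]_(m, n)) : ip X (a%:C%C *: Y) = a * ip X Y.
Proof.
rewrite !ipE mulr_sumr; apply: eq_bigr => i _; rewrite mulr_sumr.
apply: eq_bigr => j _; rewrite !mxE.
by case: (X i j) => b c; case: (Y i j) => d e /=; ring.
Qed.

Lemma ipDl m n (X Y Z : 'M[C]_(m, n)) : ip (X + Y) Z = ip X Z + ip Y Z.
Proof. by rewrite ipC ipDr !(ipC Z). Qed.

Lemma ipNl m n (X Y : 'M[C]_(m, n)) : ip (- X) Y = - ip X Y.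
Proof. by rewrite ipC ipNr ipC. Qed.

Lemma ipZl m n (a : R) (X Y : 'M[C]_(m, n)) : ip (a%:C%C *: X) Y = a * ip X Y.
Proof. by rewrite ipC ipZr ipC. Qed.

Lemma ip0r m n (X : 'M[C]_(m, n)) : ip X 0 = 0.
Proof. by rewrite /ip mulmx0 mxtrace0. Qed.

Lemma ip_ge0 m n (X : 'M[C]_(m, n)) : 0 <= ip X X.
Proof.
rewrite ipE; apply: sumr_ge0 => i _; apply: sumr_ge0 => j _.
by rewrite -!expr2 addr_ge0 ?sqr_ge0.
Qed.

Lemma normsq_le_ip m n (X : 'M[C]_(m, n)) i j :
  complex.Re (X i j) ^+ 2 + complex.Im (X i j) ^+ 2 <= ip X X.
Proof.
rewrite ipE (bigD1 i) //= (bigD1 j) //= -!expr2 -addrA ler_wpDr //.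
rewrite addr_ge0 //; last apply: sumr_ge0 => k _;
  by apply: sumr_ge0 => l _; rewrite -!expr2 addr_ge0 ?sqr_ge0.
Qed.

Lemma fro_ge0 m n (X : 'M[C]_(m, n)) : 0 <= fro X.
Proof. exact: sqrtr_ge0. Qed.

Lemma fro_sqr m n (X : 'M[C]_(m, n)) : fro X ^+ 2 = ip X X.
Proof. by rewrite sqr_sqrtr ?ip_ge0. Qed.

Lemma fro_eq0 m n (X : 'M[C]_(m, n)) : fro X <= 0 -> X = 0.
Proof.
move=> X0; have {}X0 : fro X = 0 by apply/eqP; rewrite eq_le X0 fro_ge0.
apply/matrixP => i j; rewrite mxE; apply/eqP; rewrite eq_complex.
have := normsq_le_ip X i j; rewrite -fro_sqr X0 expr0n /=.
move=> le0; have/eqP : complex.Re (X i j) ^+ 2 + complex.Im (X i j) ^+ 2 = 0.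
  by apply/eqP; rewrite eq_le le0 addr_ge0 ?sqr_ge0.
by rewrite paddr_eq0 ?sqr_ge0 // !sqrf_eq0.
Qed.

Lemma fro0 m n : fro (0 : 'M[C]_(m, n)) = 0.
Proof. by rewrite /fro ip0r sqrtr0. Qed.

Lemma fro_gt0 m n (X : 'M[C]_(m, n)) : X != 0 -> 0 < fro X.
Proof. by rewrite ltNge; apply: contra => /fro_eq0 ->. Qed.

Lemma fro_le m n p q (X : 'M[C]_(m, n)) (Y : 'M[C]_(p, q)) (a : R) :
  0 <= a -> ip X X <= a ^+ 2 * ip Y Y -> fro X <= a * fro Y.
Proof.
move=> a0 le; rewrite -(@ler_pXn2r _ 2) ?nnegrE ?mulr_ge0 ?fro_ge0 //.
by rewrite exprMn !fro_sqr.
Qed.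

(** Expanding the squared norm of |Y| X - |X| Y gives 2 x y (x y - t) >= 0, and the norms x, y are
    positive once zero matrices are set aside. *)
Lemma ip_cauchy_schwarz m n (X Y : 'M[C]_(m, n)) : ip X Y <= fro X * fro Y.
Proof.
have [->|Y0] := eqVneq Y 0; first by rewrite ip0r mulr_ge0 ?fro_ge0.
have [->|X0] := eqVneq X 0; first by rewrite ipC ip0r mulr_ge0 ?fro_ge0.
have := ip_ge0 ((fro Y)%:C%C *: X - (fro X)%:C%C *: Y).
rewrite !(ipDl, ipDr, ipNl, ipNr, ipZl, ipZr) (ipC Y X) -!fro_sqr.
have x0 := fro_gt0 X0; have y0 := fro_gt0 Y0.
set x := fro X in x0 *; set y := fro Y in y0 *; set t := ip X Y => h.
suff : 0 <= (2 * x * y) * (x * y - t).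
  by rewrite pmulr_rge0 ?subr_ge0 // !mulr_gt0.
by apply: le_trans h _; rewrite le_eqVlt; apply/orP; left; apply/eqP; ring.
Qed.

Lemma froD m n (X Y : 'M[C]_(m, n)) : fro (X + Y) <= fro X + fro Y.
Proof.
rewrite -(@ler_pXn2r _ 2) ?nnegrE ?addr_ge0 ?fro_ge0 //.
rewrite fro_sqr !(ipDl, ipDr) (ipC Y X) -!fro_sqr.
by have := ip_cauchy_schwarz X Y; nra.
Qed.

Lemma fro_conj m n (X : 'M[C]_(m, n)) : fro (conjmatrix X) = fro X.
Proof. by rewrite /fro ip_conj. Qed.

Lemma fro_adj m n (X : 'M[C]_(m, n)) : fro (adjmx X) = fro X.
Proof. by rewrite /fro ip_adj. Qed.

Lemma fro_tr m n (X : 'M[C]_(m, n)) : fro X^T = fro X.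
Proof.
have -> : X^T = adjmx (conjmatrix X) by rewrite /adjmx conjmatrixK.
by rewrite fro_adj fro_conj.
Qed.

Lemma froZ m n (c : C) (X : 'M[C]_(m, n)) :
  fro (c *: X) = Normc.normc c * fro X.
Proof.
rewrite /fro; case: c => a b /=; rewrite -sqrtrM ?addr_ge0 ?sqr_ge0 //.
congr Num.sqrt; rewrite !ipE mulr_sumr; apply: eq_bigr => i _.
rewrite mulr_sumr; apply: eq_bigr => j _; rewrite !mxE.
by case: (X i j) => d e /=; ring.
Qed.

Lemma froZr m n (a : R) (X : 'M[C]_(m, n)) :
  0 <= a -> fro (a%:C%C *: X) = a * fro X.
Proof. by move=> a0; rewrite froZ /= expr0n /= addr0 sqrtr_sqr ger0_norm. Qed.

Lemma froN m n (X : 'M[C]_(m, n)) : fro (- X) = fro X.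
Proof. by rewrite /fro ipNl ipNr opprK. Qed.

Lemma froB m n (X Y : 'M[C]_(m, n)) : fro (X - Y) <= fro X + fro Y.
Proof. by rewrite -(froN Y); exact: froD. Qed.

(** The product is a scalar s, and |s|^2 = <y, x^H s> is at most |x| |s| |y|. *)
Lemma fro_rowM n (x : 'rV[C]_n) (y : 'cV[C]_n) : fro (x *m y) <= fro x * fro y.
Proof.
set s := x *m y.
have [->|s0] := eqVneq s 0; first by rewrite fro0 mulr_ge0 ?fro_ge0.
rewrite -(ler_pM2l (fro_gt0 s0)) -expr2 fro_sqr {2}/s ipC ip_adjl ipC.
apply: le_trans (ip_cauchy_schwarz _ _) _.
rewrite mulrA ler_wpM2r ?fro_ge0 // (mx11_scalar s) mul_mx_scalar.
rewrite -[(s 0 0)%:M]scalemx1 !froZ fro_adj.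
suff -> : fro (1%:M : 'M[C]_1) = 1 by rewrite mulr1.
by rewrite /fro ipE !big_ord1 !mxE /= mulr0 addr0 mulr1 sqrtr1.
Qed.

Lemma ip_rows m n (X : 'M[C]_(m, n)) : ip X X = \sum_i ip (row i X) (row i X).
Proof.
rewrite ipE; apply: eq_bigr => i _; rewrite ipE big_ord1.
by apply: eq_bigr => j _; rewrite !mxE.
Qed.

Lemma ip_cols m n (X : 'M[C]_(m, n)) : ip X X = \sum_j ip (col j X) (col j X).
Proof.
rewrite ipE exchange_big; apply: eq_bigr => j _; rewrite ipE.
by apply: eq_bigr => i _; rewrite big_ord1 !mxE.
Qed.

(** Each entry of the product is a row times a column; summing the squared row-column bounds
    factorises the right-hand side. *)
Lemma froM m n p (X : 'M[C]_(m, n)) (Y : 'M[C]_(n, p)) :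
  fro (X *m Y) <= fro X * fro Y.
Proof.
apply: fro_le; rewrite ?fro_ge0 // fro_sqr (ip_rows X) mulr_suml ip_rows.
apply: ler_sum => i _; rewrite (ip_cols Y) mulr_sumr ip_cols.
apply: ler_sum => j _; rewrite row_mul.
have -> : col j (row i X *m Y) = row i X *m col j Y by rewrite !colE mulmxA.
rewrite -!fro_sqr -exprMn ler_pXn2r ?nnegrE ?mulr_ge0 ?fro_ge0 //.
exact: fro_rowM.
Qed.

End InnerProduct.

(** * Lower bounds, Sylvester equations and uniqueness of principal square roots *)

Section Accretive.
Variable R : realType.
Local Notation C := R[i].

(** A bound on the operator norm. The width [p] is arbitrary, so that it applies to matrix unknowns
    as well as to single vectors; [accretive] likewise bounds the Hermitian part from below. *)
Definition opbound n (K : 'M[C]_n) (k : R) :=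
  forall p (X : 'M[C]_(n, p)), fro (K *m X) <= k * fro X.
Definition accretive n (S : 'M[C]_n) (g : R) :=
  forall p (X : 'M[C]_(n, p)), g * ip X X <= ip X (S *m X).
Definition rhp_spectrum n (S : 'M[C]_n) :=
  forall z : C, eigenvalue S z -> 0 < complex.Re z.

Lemma ler_fro_mul m n (X Y : 'M[C]_(m, n)) g :
  g * ip X X <= ip X Y -> g * fro X <= fro Y.
Proof.
have [->|X0] := eqVneq X 0; first by rewrite fro0 mulr0 fro_ge0.
move=> h; rewrite -(ler_pM2l (fro_gt0 X0)) mulrCA -expr2 fro_sqr.
exact: le_trans h (ip_cauchy_schwarz _ _).
Qed.

Lemma accretive_lower n (S : 'M[C]_n) g p (X : 'M[C]_(n, p)) :
  accretive S g -> g * fro X <= fro (S *m X).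
Proof. by move=> aS; apply/ler_fro_mul/aS. Qed.

(** [S] annihilates its cokernel matrix, which the lower bound therefore forces to vanish. *)
Lemma lower_unitmx n (S : 'M[C]_n) g : 0 < g ->
  (forall p (X : 'M[C]_(n, p)), g * fro X <= fro (S *m X)) -> S \in unitmx.
Proof.
move=> g0 lS; rewrite -row_full_unit -cokermx_eq0; apply/eqP/fro_eq0.
by have := lS _ (cokermx S); rewrite mulmx_coker fro0 pmulr_rle0.
Qed.

Lemma lower_inv n (S : 'M[C]_n) g : 0 < g ->
  (forall p (X : 'M[C]_(n, p)), g * fro X <= fro (S *m X)) ->
  opbound (invmx S) g^-1.
Proof.
move=> g0 lS p X; have uS := lower_unitmx g0 lS.
rewrite -(ler_pM2l g0) mulrA divff ?gt_eqF // mul1r.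
by apply: le_trans (lS _ _) _; rewrite mulKVmx.
Qed.

Lemma accretive_unitmx n (S : 'M[C]_n) g :
  0 < g -> accretive S g -> S \in unitmx.
Proof.
by move=> g0 aS; apply: (lower_unitmx g0) => p X; apply: accretive_lower.
Qed.

(** Passing to adjoints moves [S] to the other side of the unknown without changing the real inner
    product. *)
Lemma accretive_right n (S : 'M[C]_n) g p (X : 'M[C]_(p, n)) :
  accretive S g -> g * ip X X <= ip X (X *m S).
Proof.
move=> aS; rewrite -(ip_adj X (X *m S)) adjmxM -ip_adjl ipC -(ip_adj X X).
exact: aS.
Qed.

(** Pairing with [X] adds up the two accretivity bounds. *)
Lemma sylvester_lower n (S T : 'M[C]_n) g (X : 'M[C]_n) :
  accretive S g -> accretive T g ->
  (2 * g) * fro X <= fro (S *m X + X *m T).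
Proof.
move=> aS aT; apply: ler_fro_mul; rewrite ipDr.
by have := aS _ X; have := accretive_right X aT; lra.
Qed.

Lemma ip_scale_self m n (z : C) (X : 'M[C]_(m, n)) :
  ip X (z *: X) = complex.Re z * ip X X.
Proof.
rewrite !ipE mulr_sumr; apply: eq_bigr => i _; rewrite mulr_sumr.
apply: eq_bigr => j _; rewrite !mxE.
by case: z => a b; case: (X i j) => d e /=; ring.
Qed.

(** Eigenvectors are rows here: if v S = z v, then <v, v S> = Re z |v|^2, so Re z > 0. *)
Lemma pos_rhp_spectrum n (S : 'M[C]_n) :
  (forall v : 'rV[C]_n, v != 0 -> 0 < ip v (v *m S)) -> rhp_spectrum S.
Proof.
move=> pS z /eigenvalueP[v vS v0]; have := pS v v0.
by rewrite vS ip_scale_self -fro_sqr pmulr_lgt0 // exprn_gt0 // fro_gt0.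
Qed.

Lemma accretive_rhp_spectrum n (S : 'M[C]_n) g :
  0 < g -> accretive S g -> rhp_spectrum S.
Proof.
move=> g0 aS; apply: pos_rhp_spectrum => v v0.
apply: lt_le_trans (accretive_right v aS).
by rewrite mulr_gt0 // -fro_sqr exprn_gt0 // fro_gt0.
Qed.

Lemma rhp_spectrum_tr n (S : 'M[C]_n) : rhp_spectrum S -> rhp_spectrum S^T.
Proof.
move=> hS z; rewrite eigenvalue_root_char.
suff -> : char_poly S^T = char_poly S by rewrite -eigenvalue_root_char => /hS.
rewrite /char_poly -det_tr; congr (\det _).
by apply/matrixP => i j; rewrite !mxE eq_sym.
Qed.

Lemma rhp_spectrum_conj n (S : 'M[C]_n) :
  rhp_spectrum S -> rhp_spectrum (conjmatrix S).
Proof.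
move=> hS z /eigenvalueP[v vS v0].
suff /hS : eigenvalue S (conjc z) by case: (z).
apply/eigenvalueP; exists (conjmatrix v).
  rewrite -{1}(conjmatrixK S) /conjmatrix -map_mxM -/(conjmatrix S) vS.
  by rewrite map_mxZ.
by apply: contra v0 => /eqP v0; rewrite -(conjmatrixK v) v0 /conjmatrix map_mx0.
Qed.

(** A singular shift would make [- a], of nonpositive real part, an eigenvalue of [S]. *)
Lemma rhp_shift_unitmx n (S : 'M[C]_n) a :
  rhp_spectrum S -> 0 <= complex.Re a -> S + a%:M \in unitmx.
Proof.
move=> hS a0; rewrite -row_free_unit -kermx_eq0.
have -> : S + a%:M = S - (- a)%:M by rewrite raddfN opprK.
apply/negPn/negP => /hS; case: a a0 => x y /=.
by rewrite ltNge => x0 /negP; apply; rewrite oppr_le0.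
Qed.

(* Replacing D by D(T - a) = -(S + a)D with a an eigenvalue of T preserves the
   homogeneous equation; running through all eigenvalues kills D by
   Cayley-Hamilton, while each S + a is invertible. *)
Lemma sylvester_inj n (S T D : 'M[C]_n) :
  rhp_spectrum S -> rhp_spectrum T -> S *m D + D *m T = 0 -> D = 0.
Proof.
case: n => [|n] in S T D *; first by rewrite (flatmx0 D) => *.
move=> hS hT; have [rs ch] := closed_field_poly_normal (char_poly T).
rewrite (monicP (char_poly_monic T)) scale1r in ch.
have rsP a : a \in rs -> 0 < complex.Re a.
  by move=> ars; apply: hT; rewrite eigenvalue_root_char ch root_prod_XsubC.
have : D *m horner_mx T (\prod_(a <- rs) ('X - a%:P)) = 0.
  by rewrite -ch Cayley_Hamilton mulmx0.
elim: rs rsP {ch} D => [_ D|a rs IH rsP D].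
  by rewrite big_nil rmorph1 mulmx1.
rewrite big_cons rmorphM rmorphB /= horner_mx_X horner_mx_C mulmxA => DT SD.
have a0 := rsP a (mem_head _ _).
have E : D *m (T - a%:M) = - ((S + a%:M) *m D).
  rewrite mulmxBr mulmxDl mul_mx_scalar mul_scalar_mx opprD.
  by congr (_ - _); apply/eqP; rewrite -addr_eq0 addrC SD.
have D0 : D *m (T - a%:M) = 0.
  apply: IH => //; first by move=> b brs; apply: rsP; rewrite inE brs orbT.
  have -> : D *m (T - a%:M) *m T = D *m T *m (T - a%:M).
    rewrite -!mulmxA; congr (_ *m _); rewrite mulmxBl mulmxBr.
    by rewrite scalar_mxC.
  by rewrite mulmxA -mulmxDl SD mul0mx.
have uS := rhp_shift_unitmx hS (ltW a0).
rewrite -(mulKmx uS D); have/eqP := E; rewrite D0 eq_sym oppr_eq0 => /eqP ->.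
by rewrite mulmx0.
Qed.

(** The difference D = S - T solves S D + D T = S^2 - T^2 = 0. *)
Lemma principal_sqrt_uniq n (M S T : 'M[C]_n) :
  is_principal_sqrt M S -> is_principal_sqrt M T -> S = T.
Proof.
move=> [SS hS] [TT hT]; apply/eqP; rewrite -subr_eq0; apply/eqP.
apply: (sylvester_inj hS hT); rewrite mulmxBr mulmxBl SS TT.
by rewrite addrA subrK subrr.
Qed.

Lemma principal_sqrtE n (M S : 'M[C]_n) :
  is_principal_sqrt M S -> principal_sqrt M = S.
Proof.
move=> hS; rewrite /principal_sqrt /pick_mx; case: pselect => [h|[]]; last by exists S.
by case: (cid h) => T /= hT; apply: (principal_sqrt_uniq hT hS).
Qed.

(** The transpose of [S] is again a principal root of the symmetric [M], so uniqueness applies;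
    conjugation is handled in the same way. *)
Lemma principal_sqrt_tr n (M S : 'M[C]_n) :
  is_principal_sqrt M S -> M^T = M -> S^T = S.
Proof.
move=> hS MM; apply: (principal_sqrt_uniq _ hS); case: hS => SS hS; split.
  by rewrite -trmx_mul SS.
exact: rhp_spectrum_tr.
Qed.

Lemma principal_sqrt_conj n (M S : 'M[C]_n) :
  is_principal_sqrt M S -> conjmatrix M = M -> conjmatrix S = S.
Proof.
move=> hS MM; apply: (principal_sqrt_uniq _ hS); case: hS => SS hS; split.
  by rewrite -MM -SS /conjmatrix map_mxM.
exact: rhp_spectrum_conj.
Qed.

End Accretive.

(** * Geometric limits and the square root of 1 - K *)

Section SquareRoot.
Variable R : realType.
Local Notation C := R[i].

(** The intervals with centre [u k] and radius [e k] are nested, so the supremum of their left ends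
    lies in all of them. This gives the limit together with its rate. *)
Lemma geometric_cauchy_limit (u : nat -> R) (D rho : R) : 0 <= rho < 1 ->
  (forall k, `|u k.+1 - u k| <= D * rho ^+ k) ->
  exists l, forall k, `|u k - l| <= D / (1 - rho) * rho ^+ k.
Proof.
move=> /andP[r0 r1] hu; have D0 : 0 <= D.
  by have := hu 0%N; rewrite expr0 mulr1; apply: le_trans.
have r1' : 0 < 1 - rho by rewrite subr_gt0.
(* The tail from index [k] of the series with terms [D * rho ^+ j]; consecutive tails differ by one
   term. *)
set e := fun k => D / (1 - rho) * rho ^+ k.
have eS k : e k - e k.+1 = D * rho ^+ k.
  by rewrite /e exprS; field; rewrite gt_eqF.
have e0 k : 0 <= e k by rewrite /e mulr_ge0 ?exprn_ge0 // divr_ge0 // ltW.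
pose v k := u k - e k; pose w k := u k + e k.
have vS k : v k <= v k.+1.
  by have := hu k; rewrite /v -eS ler_norml => /andP[]; lra.
have wS k : w k.+1 <= w k.
  by have := hu k; rewrite /w -eS ler_norml => /andP[]; lra.
have vw i j : v i <= w j.
  apply: (@le_trans _ _ (v (maxn i j))).
    by apply: (homo_leq (@lexx _ _) (@le_trans _ _) vS); rewrite leq_maxl.
  apply: (@le_trans _ _ (w (maxn i j))).
    by have := e0 (maxn i j); rewrite /v /w; lra.
  by apply: (homo_leq (r := fun x y : R => y <= x) (@lexx _ _)
     (fun y x z a b => le_trans b a) wS); rewrite leq_maxr.
exists (sup (range v)) => k; rewrite -/(e k) ler_distlC.
have -> : u k - e k <= sup (range v).
  by apply: ub_le_sup; [exists (w 0%N) => _ [i _ <-]|exists k].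
by apply: ge_sup; [exists (v 0%N), 0%N|move=> _ [i _ <-]; exact: vw].
Qed.

(** The squared norm is a sum of 2mn squares, each at most b^2. The crude constant N + 1 avoids a
    square root, since N <= (N + 1)^2. *)
Lemma fro_le_entries m n (X : 'M[C]_(m, n)) b : 0 <= b ->
  (forall i j, `|complex.Re (X i j)| <= b /\ `|complex.Im (X i j)| <= b) ->
  fro X <= ((m * n * 2)%:R + 1) * b.
Proof.
move=> b0 hX; set N : R := (m * n * 2)%:R.
have N0 : 0 <= N by rewrite ler0n.
rewrite -(@ler_pXn2r _ 2) ?nnegrE ?mulr_ge0 ?fro_ge0 ?addr_ge0 //.
apply: (@le_trans _ _ (N * b ^+ 2)).
  rewrite fro_sqr ipE.
  apply: (@le_trans _ _ (\sum_(i < m) \sum_(j < n) (b ^+ 2 *+ 2))).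
    apply: ler_sum => i _; apply: ler_sum => j _; have [h1 h2] := hX i j.
    rewrite -!expr2 -(real_normK (num_real (complex.Re _))).
    rewrite -(real_normK (num_real (complex.Im _))) mulr2n lerD //;
      by rewrite ler_pXn2r // nnegrE.
  rewrite !sumr_const !card_ord -!mulrnA mulr_natl; rewrite le_eqVlt; apply/orP; left; apply/eqP.
  by congr (_ *+ _); ring.
by rewrite exprMn ler_wpM2r ?sqr_ge0 //; nra.
Qed.

Lemma Re_le_fro m n (X : 'M[C]_(m, n)) i j : `|complex.Re (X i j)| <= fro X.
Proof.
rewrite -(@ler_pXn2r _ 2) ?nnegrE ?fro_ge0 // fro_sqr real_normK ?num_real //.
by apply: le_trans (normsq_le_ip X i j); rewrite lerDl sqr_ge0.
Qed.

Lemma Im_le_fro m n (X : 'M[C]_(m, n)) i j : `|complex.Im (X i j)| <= fro X.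
Proof.
rewrite -(@ler_pXn2r _ 2) ?nnegrE ?fro_ge0 // fro_sqr real_normK ?num_real //.
by apply: le_trans (normsq_le_ip X i j); rewrite lerDr sqr_ge0.
Qed.

Lemma geometric_cauchy_limit_mx m n (Y : nat -> 'M[C]_(m, n)) (D rho : R) :
  0 <= rho < 1 -> (forall k, fro (Y k.+1 - Y k) <= D * rho ^+ k) ->
  exists L B, forall k, fro (Y k - L) <= B * rho ^+ k.
Proof.
move=> r01 hY; have /andP[r0 r1] := r01.
have hRe' i j : exists l, forall k,
    `|complex.Re (Y k i j) - l| <= D / (1 - rho) * rho ^+ k.
  apply: (geometric_cauchy_limit (u := fun k => complex.Re (Y k i j))) => // k.
  apply: le_trans (hY k); apply: le_trans (Re_le_fro _ i j).
  by rewrite !mxE; case: (Y k.+1 i j); case: (Y k i j).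
have hIm' i j : exists l, forall k,
    `|complex.Im (Y k i j) - l| <= D / (1 - rho) * rho ^+ k.
  apply: (geometric_cauchy_limit (u := fun k => complex.Im (Y k i j))) => // k.
  apply: le_trans (hY k); apply: le_trans (Im_le_fro _ i j).
  by rewrite !mxE; case: (Y k.+1 i j); case: (Y k i j).
have [lr lrP] : exists f : 'I_m -> 'I_n -> R, forall i j k,
    `|complex.Re (Y k i j) - f i j| <= D / (1 - rho) * rho ^+ k.
  exists (fun i j => sval (cid (hRe' i j))) => i j k.
  by case: (cid (hRe' i j)) => l /= ->.
have [li liP] : exists f : 'I_m -> 'I_n -> R, forall i j k,
    `|complex.Im (Y k i j) - f i j| <= D / (1 - rho) * rho ^+ k.
  exists (fun i j => sval (cid (hIm' i j))) => i j k.
  by case: (cid (hIm' i j)) => l /= ->.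
exists (\matrix_(i, j) (lr i j +i* li i j)%C).
exists (((m * n * 2)%:R + 1) * (D / (1 - rho))) => k.
rewrite -mulrA; apply: fro_le_entries => [|i j].
  have D0 : 0 <= D.
    by have := hY 0%N; rewrite expr0 mulr1; apply: le_trans; exact: fro_ge0.
  by rewrite mulr_ge0 ?exprn_ge0 // divr_ge0 // subr_ge0 ltW.
rewrite !mxE; split.
  by have := lrP i j k; case: (Y k i j).
by have := liP i j k; case: (Y k i j).
Qed.

(** Lets estimates for iterates pass to their limit. *)
Lemma ler_geometric (a b D rho : R) : 0 <= rho < 1 ->
  (forall k, a <= b + D * rho ^+ k) -> a <= b.
Proof.
move=> /andP[r0 r1] h.
have c : (fun k : nat => b + D * rho ^+ k) @ \oo --> b + D * 0.
  apply: cvgD; first exact: cvg_cst.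
  by apply: cvgMr; apply: cvg_expr; rewrite ger0_norm.
rewrite mulr0 addr0 in c; rewrite -(cvg_lim _ c) //.
by apply: limr_ge; [apply/cvg_ex; exists b|exists 0%N].
Qed.

(** By duality: with U = X K, |U|^2 = <K U^H, X^H> <= k |U| |X|. *)
Lemma opbound_right m n (K : 'M[C]_n) k (X : 'M[C]_(m, n)) :
  0 <= k -> opbound K k -> fro (X *m K) <= k * fro X.
Proof.
move=> k0 bK; set U := X *m K; have [->|U0] := eqVneq U 0.
  by rewrite fro0 mulr_ge0 ?fro_ge0.
rewrite -(ler_pM2l (fro_gt0 U0)) -expr2 fro_sqr {2}/U -ip_adj adjmxM -ip_adjl.
apply: le_trans (ip_cauchy_schwarz _ _) _; rewrite fro_adj mulrA.
rewrite ler_wpM2r ?fro_ge0 // mulrC.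
by apply: le_trans (bK _ _) _; rewrite -adjmxM fro_adj.
Qed.

(* The fixed point of Y = (K + Y^2)/2 gives (1 - Y)^2 = 1 - K; on the ball of
   operator radius rho = (1 + k)/2 this map is a rho-contraction. *)
Lemma sqrt_one_sub n (K : 'M[C]_n) (k : R) : 0 <= k < 1 -> opbound K k ->
  exists2 Y : 'M[C]_n, opbound Y ((1 + k) / 2) &
    (1%:M - Y) *m (1%:M - Y) = 1%:M - K.
Proof.
move=> /andP[k0 k1] bK; set rho := (1 + k) / 2.
have r01 : 0 <= rho < 1 by rewrite /rho; apply/andP; split; lra.
have /andP[r0 r1] := r01.
(* Invariance of the ball: [F] takes the bound [rho] to (k + rho^2) / 2. As k = 2 rho - 1, this is
   at most [rho] because rho^2 <= 1. *)
have kr : k + rho * rho <= 2 * rho.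
  have -> : k = 2 * rho - 1 by rewrite /rho; lra.
  suff : rho * rho <= 1 by lra.
  by rewrite -[leRHS](mulr1 1); apply: ler_pM => //; exact: ltW.
clearbody rho.
pose F (Y : 'M[C]_n) := (2^-1%:C)%C *: (K + Y *m Y).
have h0 : 0 <= 2^-1 :> R by rewrite invr_ge0.
have FB Y : opbound Y rho -> opbound (F Y) rho.
  move=> bY p X; rewrite /F -scalemxAl froZr // mulmxDl ler_pdivrMl //.
  apply: le_trans (froD _ _) _; rewrite -mulmxA.
  apply: le_trans
    (lerD (bK _ X) (le_trans (bY _ _) (ler_wpM2l r0 (bY _ X)))) _.
  by rewrite !mulrA -mulrDl ler_wpM2r ?fro_ge0.
have FC Y Z : opbound Y rho -> opbound Z rho ->
    fro (F Y - F Z) <= rho * fro (Y - Z).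
  move=> bY bZ; rewrite /F -scalerBr froZr //.
  (* A difference of squares for noncommuting matrices, with one factor on each side; hence the use
     of both left and right operator bounds. *)
  have -> : K + Y *m Y - (K + Z *m Z) = Y *m (Y - Z) + (Y - Z) *m Z.
    rewrite mulmxBr mulmxBl addrA subrK.
    by rewrite opprD addrACA subrr add0r.
  rewrite ler_pdivrMl //; apply: le_trans (froD _ _) _.
  apply: le_trans (lerD (bY _ _) (opbound_right _ r0 bZ)) _.
  by rewrite mulr_natl mulr2n.
pose Y k := iter k F 0.
have Y0 : Y 0%N = 0 by [].
have YS j : Y j.+1 = F (Y j) by [].
have FE Z : F Z = (2^-1%:C)%C *: (K + Z *m Z) by [].
clearbody Y F.
have bY j : opbound (Y j) rho.
  elim: j => [|j IH]; last by rewrite YS; exact: FB.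
  by move=> p X; rewrite Y0 mul0mx fro0 mulr_ge0 ?fro_ge0.
have YC j : fro (Y j.+1 - Y j) <= fro (Y 1%N - Y 0%N) * rho ^+ j.
  elim: j => [|j IH]; first by rewrite expr0 mulr1.
  have -> : Y j.+2 - Y j.+1 = F (Y j.+1) - F (Y j) by rewrite !YS.
  apply: le_trans (FC (Y j.+1) (Y j) (bY _) (bY _)) _.
  by rewrite exprS mulrCA ler_wpM2l.
have [L [B LP]] := geometric_cauchy_limit_mx r01 YC.
have bL : opbound L rho.
  move=> p X; apply: (@ler_geometric _ _ (B * fro X) rho r01) => j.
  have -> : L *m X = Y j *m X - (Y j - L) *m X by rewrite mulmxBl subKr.
  apply: le_trans (froB _ _) _; apply: lerD; first exact: bY.
  apply: le_trans (froM _ _) _.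
  by rewrite mulrAC ler_wpM2r ?fro_ge0.
(* [L] is compared with [Y j] before the map and with [Y j.+1] after it; both errors are geometric
   in [j]. *)
have FL : F L = L.
  apply/eqP; rewrite -subr_eq0; apply/eqP/fro_eq0.
  apply: (@ler_geometric _ _ (rho * B + B * rho) rho r01) => j.
  have -> : F L - L = (F L - F (Y j)) + (Y j.+1 - L) by rewrite YS addrA subrK.
  apply: le_trans (froD _ _) _; rewrite add0r mulrDl; apply: lerD.
    apply: le_trans (FC L (Y j) bL (bY _)) _.
    by rewrite -mulrA ler_wpM2l // -froN opprB.
  by have := LP j.+1; rewrite exprS mulrA.
exists L => //; rewrite mulmxBl mul1mx mulmxBr mulmx1.
(* The fixed point equation reads L^2 = 2 L - K, whence (1 - L)^2 = 1 - K. *)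
have -> : L *m L = L + L - K.
  rewrite -{3 4}FL FE -scalerDl -rmorphD /=.
  have -> : 2^-1 + 2^-1 = 1 :> R by lra.
  by rewrite rmorph1 scale1r addrC addKr.
by rewrite opprB [L + L - K - L]addrAC addrK addrA subrK.
Qed.

End SquareRoot.

(** * Existence of accretive principal roots; convergence of the Newton iteration *)

Section Existence.
Variable R : realType.
Local Notation C := R[i].

(** [a] may be negative: [Num.sqrt a] is then 0, and the hypothesis forces [X] to vanish. *)
Lemma fro_le_sqrt m n p q (X : 'M[C]_(m, n)) (Y : 'M[C]_(p, q)) (a : R) :
  ip X X <= a * ip Y Y -> fro X <= Num.sqrt a * fro Y.
Proof.
by move=> h; rewrite mulrC -sqrtrM ?ip_ge0 // mulrC; apply: ler_wsqrtr.
Qed.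

Lemma opbound_fro n (K : 'M[C]_n) : opbound K (fro K).
Proof. by move=> p X; apply: froM. Qed.

Lemma opbound_le n (K : 'M[C]_n) a b : a <= b -> opbound K a -> opbound K b.
Proof.
move=> ab bK p X; apply: le_trans (bK _ X) _.
by rewrite ler_wpM2r ?fro_ge0.
Qed.

Lemma opboundD n (K L : 'M[C]_n) a b :
  opbound K a -> opbound L b -> opbound (K + L) (a + b).
Proof.
move=> bK bL p X; rewrite mulmxDl mulrDl.
exact: le_trans (froD _ _) (lerD (bK _ X) (bL _ X)).
Qed.

Lemma opboundM n (K L : 'M[C]_n) a b : 0 <= a ->
  opbound K a -> opbound L b -> opbound (K *m L) (a * b).
Proof.
move=> a0 bK bL p X; rewrite -mulmxA -mulrA.
by apply: le_trans (bK _ _) _; rewrite ler_wpM2l.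
Qed.

Lemma one_sub_lower n (G : 'M[C]_n) q p (X : 'M[C]_(n, p)) :
  opbound G q -> (1 - q) * fro X <= fro ((1%:M - G) *m X).
Proof.
move=> bG; rewrite mulrBl mul1r lerBlDr.
apply: le_trans (lerD (lexx _) (bG _ X)).
apply: le_trans (froD _ _).
by rewrite mulmxBl mul1mx subrK.
Qed.

Lemma real_complexM (a b : R) : ((a * b)%:C)%C = (a%:C * b%:C)%C.
Proof. by rewrite rmorphM. Qed.

(** Take S = d (1 - Y) with |Y| <= (1 + k) / 2 in operator norm: then 1 - |Y| >= (1 - k) / 2 gives
    accretivity and 1 + |Y| <= 2 the upper bound. *)
Lemma principal_sqrt_exists n (M : 'M[C]_n) (d k : R) :
  0 < d -> 0 <= k < 1 ->
  opbound (1%:M - ((d ^- 2)%:C)%C *: M) k ->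
  exists S, [/\ is_principal_sqrt M S, accretive S (d * ((1 - k) / 2))
              & opbound S (2 * d)].
Proof.
move=> d0 k01 bK; have [Y bY YY] := sqrt_one_sub k01 bK.
have /andP[k0 k1] := k01.
have aS : accretive ((d%:C)%C *: (1%:M - Y)) (d * ((1 - k) / 2)).
  move=> p X; rewrite -scalemxAl ipZr -mulrA ler_pM2l // mulmxBl mul1mx.
  rewrite ipDr ipNr lerBrDl.
  have := le_trans (ip_cauchy_schwarz X (Y *m X))
    (ler_wpM2l (fro_ge0 X) (bY _ X)).
  rewrite mulrCA -expr2 fro_sqr => h.
  apply: le_trans (lerD h (lexx _)) _.
  rewrite -mulrDl -[leRHS]mul1r ler_wpM2r ?ip_ge0 //; lra.
exists ((d%:C)%C *: (1%:M - Y)); split=> //.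
  split; last first.
    by apply: accretive_rhp_spectrum aS; rewrite mulr_gt0 // divr_gt0 // subr_gt0.
  rewrite -scalemxAl -scalemxAr YY opprB addrC subrK !scalerA.
  rewrite -!real_complexM (_ : d * d * d ^- 2 = 1) ?scale1r //.
  by rewrite -expr2 divff // expf_neq0 // gt_eqF.
move=> p X; rewrite -scalemxAl (froZr _ (ltW d0)) [2 * d]mulrC -mulrA (ler_pM2l d0).
rewrite mulmxBl mul1mx; apply: le_trans (froB _ _) _.
apply: le_trans (lerD (lexx _) (bY _ X)) _.
rewrite -{1}[fro X]mul1r -mulrDl ler_wpM2r ?fro_ge0 //; lra.
Qed.

(** The rank of a product is at most that of its right factor. Since the transpose does not
    conjugate, invertibility of the Gram matrix is stronger than full rank. *)
Lemma mxrank_gram_unit m n (X : 'M[C]_(m, n)) :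
  X^T *m X \in unitmx -> mxrank X = n.
Proof.
move=> uX; apply/eqP; rewrite eqn_leq rank_leq_col /=.
by rewrite -{1}(mxrank_unit uX) mxrankM_maxr.
Qed.

(* The Cayley transform G_k = (S_k - 1)(S_k + 1)^-1 of the iterates is squared
   at each step. *)
Lemma newton_iterE m n (Q : 'M[C]_(m, n)) (S G0 : 'M[C]_n) q : 0 <= q < 1 ->
  Q^T *m Q = 1%:M -> S^T = S -> opbound G0 q ->
  S *m (1%:M - G0) = 1%:M + G0 ->
  forall k, exists T G : 'M[C]_n,
  [/\ newton_iter (Q *m S) k = Q *m T, T^T = T, T \in unitmx,
      opbound G (q ^+ k.+1) & T *m (1%:M - G) = 1%:M + G].
Proof.
move=> /andP[q0 q1] QQ SS bG0 SG0.
(* 1 + G is invertible because [G] is a strict contraction, and the Cayley relation passes this on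
   to [T]. *)
have unitT (T G : 'M[C]_n) k : opbound G (q ^+ k.+1) ->
    T *m (1%:M - G) = 1%:M + G -> T \in unitmx.
  move=> bG TG; suff : T *m (1%:M - G) \in unitmx.
    by rewrite unitmx_mul => /andP[].
  rewrite TG -[G]opprK; apply: (@lower_unitmx _ _ _ (1 - q ^+ k.+1)).
    by rewrite subr_gt0 exprn_ilt1.
  move=> p X; apply: one_sub_lower => r Z.
  by rewrite mulNmx froN.
elim=> [|k [T [G [XE TT uT bG TG]]]].
  by exists S, G0; split=> //; apply: (unitT _ G0 0%N).
(* As Q^T Q = 1, a step on Q T amounts to replacing [T] by (T + T^-1) / 2. *)
pose T' := (2^-1 : C) *: (T + invmx T).
have T'G : T' *m (1%:M - G *m G) = 1%:M + G *m G.
  have E1 : T *m (1%:M - G *m G) = 1%:M + G + G + G *m G.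
    have -> : 1%:M - G *m G = (1%:M - G) *m (1%:M + G).
      by rewrite mulmxDr mulmx1 mulmxBl mul1mx addrA subrK.
    by rewrite mulmxA TG mulmxDr mulmx1 mulmxDl mul1mx !addrA.
  have E2 : invmx T *m (1%:M - G *m G) = 1%:M - G - G + G *m G.
    have -> : 1%:M - G *m G = (1%:M + G) *m (1%:M - G).
      by rewrite mulmxBr mulmx1 mulmxDl mul1mx opprD addrA addrK.
    rewrite mulmxA -TG mulKmx // mulmxBr mulmx1 mulmxBl mul1mx.
    by rewrite opprB addrA addrAC.
  rewrite /T' -scalemxAl mulmxDl E1 E2.
  set H := G *m G; clearbody H.
  have -> : 1%:M + G + G + H + (1%:M - G - G + H) = (2 : C) *: (1%:M + H).
    by apply/matrixP => i j; rewrite !mxE; ring.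
  rewrite scalerA mulVf ?scale1r //.
(* The square has the bound q^(2k+2), relaxed here to one extra factor [q]. *)
have bGG : opbound (G *m G) (q ^+ k.+2).
  apply: opbound_le (opboundM (exprn_ge0 _ q0) bG bG).
  by rewrite [leRHS]exprSr ler_wpM2l ?exprn_ge0 // -[leRHS]expr1 ler_wiXn2l // ltW.
exists T', (G *m G); split=> //; last exact: unitT bGG T'G.
  rewrite /= XE trmx_mul TT -!mulmxA (mulmxA Q^T) QQ mul1mx -scalemxAr.
  congr (_ *: (Q *m _)); rewrite mulmxDr mulmx1; congr (_ + _).
  have uTT : T *m T \in unitmx by rewrite unitmx_mul uT.
  by rewrite -[RHS](mulmxK uTT) mulKmx.
by rewrite /T' linearZ linearD /= trmx_inv TT.
Qed.

(** The Cayley transform of an accretive bounded [S] is a strict contraction, so the transforms of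
    the iterates tend to 0 and the square factors to 1. *)
Lemma newton_iter_cvg m n (Q : 'M[C]_(m, n)) (S : 'M[C]_n) g s :
  0 < g -> 0 <= s -> Q^T *m Q = 1%:M -> S^T = S -> accretive S g -> opbound S s ->
  exists D q, [/\ 0 <= q < 1,
    forall k, mxrank (newton_iter (Q *m S) k) = n
  & forall k, fro (newton_iter (Q *m S) k - Q) <= D * q ^+ k].
Proof.
move=> g0 s0 QQ SS aS bS.
have aS1 : accretive (S + 1%:M) g.
  move=> p X; rewrite mulmxDl mul1mx ipDr.
  by rewrite -[leLHS]addr0 lerD ?ip_ge0.
have uS1 := accretive_unitmx g0 aS1.
pose G0 := (S - 1%:M) *m invmx (S + 1%:M).
(* From |(S - 1) W|^2 = |(S + 1) W|^2 - 4 <W, S W>, with <W, S W> >= g |W|^2 and |(S + 1) W| <= (s +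
   1) |W|. *)
pose q := Num.sqrt (1 - 4 * g / (s + 1) ^+ 2).
have s1 : 0 < (s + 1) ^+ 2 by rewrite exprn_gt0 // ltr_wpDl.
have q01 : 0 <= q < 1.
  rewrite sqrtr_ge0 /= -[ltRHS]sqrtr1 ltr_sqrt // ltrBlDr ltrDl.
  by rewrite divr_gt0 // mulr_gt0.
have bG0 : opbound G0 q.
  move=> p X; apply: fro_le_sqrt; rewrite /G0 -mulmxA.
  set W := invmx (S + 1%:M) *m X.
  have XE : X = (S + 1%:M) *m W by rewrite /W mulKVmx.
  rewrite [in leRHS]XE; clearbody W; move: (aS _ W) (bS _ W).
  rewrite !mulmxDl mulNmx mul1mx !(ipDl, ipDr, ipNl, ipNr).
  rewrite (ipC (S *m W) W) -!fro_sqr; set a := fro (S *m W); set b := ip W _.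
  set w := fro W => h1 h2; have a0 : 0 <= a by exact: fro_ge0.
  have w0 : 0 <= w by exact: fro_ge0.
  have cs : b <= w * a by exact: ip_cauchy_schwarz.
  clearbody a b w; clear -h1 h2 a0 w0 cs s1 g0 s0.
  rewrite mulrBl mul1r.
  suff : 4 * g / (s + 1) ^+ 2 * (a ^+ 2 + b + (b + w ^+ 2)) <= 4 * b by lra.
  apply: (@le_trans _ _ (4 * g / (s + 1) ^+ 2 * ((s + 1) * w) ^+ 2)).
    apply: ler_wpM2l; first by rewrite divr_ge0 ?(ltW s1) ?(mulr_ge0 (ler0n _ 4) (ltW g0)).
    by nra.
  have -> : 4 * g / (s + 1) ^+ 2 * ((s + 1) * w) ^+ 2 = 4 * (g * w ^+ 2).
    by field; rewrite gt_eqF // ltr_wpDl.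
  by rewrite ler_pM2l.
have SG0 : S *m (1%:M - G0) = 1%:M + G0.
  have E : G0 *m (S + 1%:M) = S - 1%:M by rewrite /G0 mulmxKV.
  rewrite -[LHS](mulmxK uS1) -[RHS](mulmxK uS1); congr (_ *m _).
  rewrite -mulmxA mulmxBl mulmxDl E mul1mx.
  have -> : S + 1%:M - (S - 1%:M) = 1%:M + 1%:M by rewrite opprB addrCA [S + 1%:M]addrC addrK.
  by rewrite mulmxDr mulmx1 [S + 1%:M + _]addrACA subrr addr0.
have /andP[q0 q1] := q01.
have iter_k := newton_iterE q01 QQ SS bG0 SG0.
(* The constant comes from T - 1 = 2 G (1 - G)^-1, where [G] has operator bound q^(k+1) and the
   inverse 1 / (1 - q). *)
exists (fro Q * (2 * (1 - q)^-1 * fro (1%:M : 'M[C]_n))), q; split=> // k.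
  have [T [G [-> TT uT _ _]]] := iter_k k.
  apply: mxrank_gram_unit.
  by rewrite trmx_mul TT -mulmxA (mulmxA Q^T) QQ mul1mx unitmx_mul uT.
have [T [G [-> TT uT bG TG]]] := iter_k k.
have bG' : opbound G q.
  by apply: opbound_le bG; rewrite -[leRHS]expr1 ler_wiXn2l // ltW.
have lG p (X : 'M[C]_(n, p)) := one_sub_lower X bG'.
have q1' : 0 < 1 - q by rewrite subr_gt0.
have uG := lower_unitmx q1' lG.
have TE : T - 1%:M = (G + G) *m invmx (1%:M - G).
  rewrite -[LHS](mulmxK uG) mulmxBl TG mul1mx opprB [G - 1%:M]addrC.
  by rewrite addrA [1%:M + G - 1%:M]addrAC subrr add0r.
have -> : Q *m T - Q = Q *m (T - 1%:M) by rewrite mulmxBr mulmx1.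
apply: le_trans (froM _ _) _; rewrite -[leRHS]mulrA.
apply: ler_wpM2l; first exact: fro_ge0.
rewrite TE; apply: le_trans (opboundD bG bG _) _.
have := lower_inv q1' lG 1%:M; rewrite mulmx1 => h.
apply: le_trans (ler_wpM2l _ h) _; first by rewrite addr_ge0 ?exprn_ge0.
set z := (1 - q)^-1 * _; have z0 : 0 <= z.
  by rewrite mulr_ge0 ?fro_ge0 // invr_ge0 ltW.
rewrite -[2 * _ * _]mulrA -/z.
have -> : (q ^+ k.+1 + q ^+ k.+1) * z = 2 * z * q ^+ k.+1 by ring.
by apply: ler_wpM2l; [rewrite mulr_ge0|rewrite ler_wiXn2l // ltW].
Qed.

End Existence.

(** * Taylor terms of the square root and of the polar factor *)

Section Expansion.
Variable R : realType.
Local Notation C := R[i].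

Lemma conjmatrixM p q r (X : 'M[C]_(p, q)) (Y : 'M[C]_(q, r)) :
  conjmatrix (X *m Y) = conjmatrix X *m conjmatrix Y.
Proof. exact: map_mxM. Qed.

Lemma conjmatrixD p q (X Y : 'M[C]_(p, q)) :
  conjmatrix (X + Y) = conjmatrix X + conjmatrix Y.
Proof. exact: map_mxD. Qed.

Lemma conjmatrixN p q (X : 'M[C]_(p, q)) : conjmatrix (- X) = - conjmatrix X.
Proof. exact: map_mxN. Qed.

Lemma conjmatrix_tr p q (X : 'M[C]_(p, q)) : conjmatrix X^T = (conjmatrix X)^T.
Proof. by rewrite /conjmatrix map_trmx. Qed.

Lemma conjmatrix_inv p (X : 'M[C]_p) : conjmatrix (invmx X) = invmx (conjmatrix X).
Proof. exact: map_invmx. Qed.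

(** The matrix of X -> P X + X P on vectorised matrices. Inverting it as a matrix makes
    [lyapunov_inv] linear by construction, for every [P]; accretivity enters when it has to solve
    the equation. *)
Definition lyapunov_mx n (P : 'M[C]_n) : 'M[C]_(n * n) :=
  lin_mulmx P + lin_mulmxr P.
Definition lyapunov_inv n (P Y : 'M[C]_n) : 'M[C]_n :=
  vec_mx (mxvec Y *m invmx (lyapunov_mx P)).

Lemma mul_lyapunov_mx n (P X : 'M[C]_n) :
  mxvec X *m lyapunov_mx P = mxvec (P *m X + X *m P).
Proof. by rewrite /lyapunov_mx mulmxDr !mul_vec_lin -linearD. Qed.

Lemma lyapunov_inj n (P : 'M[C]_n) g (X Y : 'M[C]_n) : 0 < g -> accretive P g ->
  P *m X + X *m P = P *m Y + Y *m P -> X = Y.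
Proof.
move=> g0 aP E; apply/eqP; rewrite -subr_eq0; apply/eqP/fro_eq0.
have := sylvester_lower (X - Y) aP aP.
have -> : P *m (X - Y) + (X - Y) *m P = 0.
  by rewrite mulmxBr mulmxBl addrACA E -opprD subrr.
by rewrite fro0 pmulr_rle0 // mulr_gt0.
Qed.

Lemma lyapunov_invE n (P : 'M[C]_n) g (Y : 'M[C]_n) : 0 < g -> accretive P g ->
  P *m lyapunov_inv P Y + lyapunov_inv P Y *m P = Y.
Proof.
move=> g0 aP; have uL : lyapunov_mx P \in unitmx.
  rewrite -row_free_unit; apply/inj_row_free => v.
  rewrite -[v]vec_mxK mul_lyapunov_mx => E.
  suff -> : vec_mx v = 0 by rewrite linear0.
  apply: (lyapunov_inj g0 aP); rewrite mulmx0 mul0mx addr0.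
  by apply: (can_inj mxvecK); rewrite linear0.
apply: (can_inj mxvecK); rewrite -mul_lyapunov_mx /lyapunov_inv vec_mxK.
by rewrite mulmxKV.
Qed.

Lemma lyapunov_inv_linear n (P : 'M[C]_n) (c : C) X Y :
  lyapunov_inv P (c *: X + Y) = c *: lyapunov_inv P X + lyapunov_inv P Y.
Proof. by rewrite /lyapunov_inv linearP mulmxDl -scalemxAl linearP. Qed.

Lemma fro_lyapunov_inv n (P : 'M[C]_n) g (Y : 'M[C]_n) : 0 < g -> accretive P g ->
  fro (lyapunov_inv P Y) <= (2 * g)^-1 * fro Y.
Proof.
move=> g0 aP; rewrite ler_pdivlMl ?mulr_gt0 //.
by rewrite -{2}(lyapunov_invE Y g0 aP); apply: sylvester_lower.
Qed.

(** Both sides solve the same Lyapunov equation, because conjugation fixes [P]. *)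
Lemma lyapunov_inv_conj n (P : 'M[C]_n) g (Y : 'M[C]_n) : 0 < g ->
  accretive P g -> conjmatrix P = P ->
  conjmatrix (lyapunov_inv P Y) = lyapunov_inv P (conjmatrix Y).
Proof.
move=> g0 aP PP; apply: (lyapunov_inj g0 aP).
rewrite (lyapunov_invE _ g0 aP) -{1 4}PP -!conjmatrixM -conjmatrixD.
by rewrite (lyapunov_invE _ g0 aP).
Qed.

(** A big-O on an explicit ball, uniform in the direction of [Z]: sums keep orders and products add
    them. *)
Definition ordbig m n p q (d : R) (F : 'M[C]_(m, n) -> 'M[C]_(p, q)) (k : nat) :=
  exists2 c : R, 0 <= c & forall Z, fro Z <= d -> fro (F Z) <= c * fro Z ^+ k.

Lemma ordbig_cst m n p q d (A : 'M[C]_(p, q)) : ordbig d (fun _ : 'M[C]_(m, n) => A) 0.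
Proof. by exists (fro A); [exact: fro_ge0|move=> Z _; rewrite mulr1]. Qed.

Lemma ordbig_id m n d : ordbig d (@id 'M[C]_(m, n)) 1.
Proof. by exists 1 => // Z _; rewrite mul1r. Qed.

Lemma ordbig_tr m n d : ordbig d (@trmx C m n) 1.
Proof. by exists 1 => // Z _; rewrite mul1r fro_tr. Qed.

Lemma ordbigM m n p q r d (F : 'M[C]_(m, n) -> 'M[C]_(p, q))
    (G : 'M[C]_(m, n) -> 'M[C]_(q, r)) j k :
  ordbig d F j -> ordbig d G k -> ordbig d (fun Z => F Z *m G Z) (j + k).
Proof.
move=> [a a0 Fa] [b b0 Gb]; exists (a * b); first exact: mulr_ge0.
move=> Z Zd; apply: le_trans (froM _ _) _; rewrite exprD mulrACA.
by apply: ler_pM (Fa _ Zd) (Gb _ Zd); exact: fro_ge0.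
Qed.

Lemma ordbigD m n p q d (F G : 'M[C]_(m, n) -> 'M[C]_(p, q)) k :
  ordbig d F k -> ordbig d G k -> ordbig d (fun Z => F Z + G Z) k.
Proof.
move=> [a a0 Fa] [b b0 Gb]; exists (a + b); first exact: addr_ge0.
move=> Z Zd; rewrite mulrDl.
exact: le_trans (froD _ _) (lerD (Fa _ Zd) (Gb _ Zd)).
Qed.

Lemma ordbigN m n p q d (F : 'M[C]_(m, n) -> 'M[C]_(p, q)) k :
  ordbig d F k -> ordbig d (fun Z => - F Z) k.
Proof. by move=> [a a0 Fa]; exists a => // Z Zd; rewrite froN; exact: Fa. Qed.

Lemma ordbigW m n p q d (F : 'M[C]_(m, n) -> 'M[C]_(p, q)) j k :
  d <= 1 -> (k <= j)%N -> ordbig d F j -> ordbig d F k.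
Proof.
move=> d1 kj [a a0 Fa]; exists a => // Z Zd; apply: le_trans (Fa _ Zd) _.
by apply: ler_wpM2l => //; rewrite ler_wiXn2l ?fro_ge0 // (le_trans Zd).
Qed.

Lemma ordbig_sub m n p q d e (F : 'M[C]_(m, n) -> 'M[C]_(p, q)) k :
  e <= d -> ordbig d F k -> ordbig e F k.
Proof.
by move=> ed [a a0 Fa]; exists a => // Z Ze; apply: Fa; apply: le_trans ed.
Qed.

Lemma ordbig_dom m n p q p' q' d (F : 'M[C]_(m, n) -> 'M[C]_(p, q))
    (G : 'M[C]_(m, n) -> 'M[C]_(p', q')) k c : 0 <= c ->
  (forall Z, fro Z <= d -> fro (G Z) <= c * fro (F Z)) ->
  ordbig d F k -> ordbig d G k.
Proof.
move=> c0 GF [a a0 Fa]; exists (c * a); first exact: mulr_ge0.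
move=> Z Zd; apply: le_trans (GF _ Zd) _.
by rewrite -mulrA; apply: ler_wpM2l (Fa _ Zd).
Qed.

Lemma ordbig_small m n p q d (F : 'M[C]_(m, n) -> 'M[C]_(p, q)) e :
  0 < d -> 0 < e -> ordbig d F 1 ->
  exists d', [/\ 0 < d', d' <= d & forall Z, fro Z <= d' -> fro (F Z) <= e].
Proof.
move=> d0 e0 [c c0 Fc]; have c1 : 0 < c + 1 by rewrite ltr_wpDl.
(* The constant [c] may be zero, hence the denominator [c + 1]. *)
exists (Num.min d (e / (c + 1))); split; last 2 first.
- by rewrite ge_min lexx.
- move=> Z; rewrite le_min => /andP[Zd]; rewrite ler_pdivlMr // => Ze.
  apply: le_trans (Fc _ Zd) _; apply: le_trans _ Ze.
  by rewrite expr1 mulrC ler_wpM2l ?fro_ge0 // lerDl.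
by rewrite lt_min d0 divr_gt0.
Qed.

Definition sqrt_gram m n (B : 'M[C]_(m, n)) := principal_sqrt (B^T *m B).

(* First and second order terms of sqrt_gram (B + Z) and polarC (B + Z) in Z. *)
Definition sqrt_gram1 m n (B Z : 'M[C]_(m, n)) :=
  lyapunov_inv (sqrt_gram B) (B^T *m Z + Z^T *m B).
Definition sqrt_gram2 m n (B Z : 'M[C]_(m, n)) :=
  lyapunov_inv (sqrt_gram B) (Z^T *m Z - sqrt_gram1 B Z *m sqrt_gram1 B Z).
Definition polarC1 m n (B Z : 'M[C]_(m, n)) :=
  (Z - polarC B *m sqrt_gram1 B Z) *m invmx (sqrt_gram B).
Definition polarC2 m n (B Z : 'M[C]_(m, n)) :=
  - (polarC1 B Z *m sqrt_gram1 B Z + polarC B *m sqrt_gram2 B Z)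
  *m invmx (sqrt_gram B).

(** The constants do not refer to [B], so that one pair can serve a whole neighbourhood of a base
    point. *)
Definition good_gram m n (B : 'M[C]_(m, n)) (g s : R) :=
  [/\ is_principal_sqrt (B^T *m B) (sqrt_gram B), (sqrt_gram B)^T = sqrt_gram B,
      accretive (sqrt_gram B) g & opbound (sqrt_gram B) s].

(** With S symmetric and S^2 = B^T B, the factor Q = B S^-1 satisfies Q^T Q = S^-1 S^2 S^-1 = 1. *)
Lemma good_gram_polar m n (B : 'M[C]_(m, n)) g s : 0 < g -> good_gram B g s ->
  polarC B *m sqrt_gram B = B /\ (polarC B)^T *m polarC B = 1%:M.
Proof.
move=> g0 [[SS _] ST aS _]; have uS := accretive_unitmx g0 aS.
rewrite /polarC -/(sqrt_gram B) mulmxKV //; split=> //.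
by rewrite trmx_mul trmx_inv ST -mulmxA (mulmxA B^T) -SS -mulmxA mulmxV // mulmx1 mulVmx.
Qed.

Lemma good_gram_conj m n (B : 'M[C]_(m, n)) g s : good_gram B g s ->
  conjmatrix B = B -> conjmatrix (sqrt_gram B) = sqrt_gram B.
Proof.
move=> [hS _ _ _] BB; apply: (principal_sqrt_conj hS).
by rewrite conjmatrixM conjmatrix_tr BB.
Qed.

Lemma sqrt_gram1_linear m n (B : 'M[C]_(m, n)) (c : C) X Y :
  sqrt_gram1 B (c *: X + Y) = c *: sqrt_gram1 B X + sqrt_gram1 B Y.
Proof.
rewrite /sqrt_gram1 -lyapunov_inv_linear; congr lyapunov_inv.
rewrite mulmxDr linearP mulmxDl -scalemxAr -scalemxAl scalerDr.
by rewrite addrACA.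
Qed.

Lemma polarC1_linear m n (B : 'M[C]_(m, n)) (c : C) X Y :
  polarC1 B (c *: X + Y) = c *: polarC1 B X + polarC1 B Y.
Proof.
rewrite /polarC1 sqrt_gram1_linear scalemxAl -mulmxDl; congr (_ *m _).
by rewrite mulmxDr -scalemxAr opprD addrACA -scalerBr.
Qed.

Lemma lyapunov_invZ n (P : 'M[C]_n) (c : C) X :
  lyapunov_inv P (c *: X) = c *: lyapunov_inv P X.
Proof.
have L0 : lyapunov_inv P 0 = 0 by rewrite /lyapunov_inv linear0 mul0mx linear0.
by rewrite -[c *: X]addr0 lyapunov_inv_linear L0 addr0.
Qed.

Lemma sqrt_gram1Z m n (B : 'M[C]_(m, n)) (c : C) X :
  sqrt_gram1 B (c *: X) = c *: sqrt_gram1 B X.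
Proof.
rewrite /sqrt_gram1 -lyapunov_invZ; congr lyapunov_inv.
by rewrite [(c *: X)^T]linearZ /= -scalemxAr -scalemxAl scalerDr.
Qed.

Lemma polarC1Z m n (B : 'M[C]_(m, n)) (c : C) X :
  polarC1 B (c *: X) = c *: polarC1 B X.
Proof. by rewrite /polarC1 sqrt_gram1Z -scalemxAr -scalerBr -scalemxAl. Qed.

(** At c = ih the factor [c * c] is real, which keeps the second order term out of the imaginary
    part. *)
Lemma polarC2Z m n (B : 'M[C]_(m, n)) (c : C) X :
  polarC2 B (c *: X) = (c * c) *: polarC2 B X.
Proof.
have S2 : sqrt_gram2 B (c *: X) = (c * c) *: sqrt_gram2 B X.
  rewrite /sqrt_gram2 sqrt_gram1Z -lyapunov_invZ; congr lyapunov_inv.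
  by rewrite [(c *: X)^T]linearZ /= -!scalemxAr -!scalemxAl !scalerA scalerBr.
rewrite /polarC2 S2 polarC1Z sqrt_gram1Z -!scalemxAr -!scalemxAl scalerA.
by rewrite -scalerDr -scalerN -scalemxAl.
Qed.

(** * Conjugation symmetry of the Taylor terms at a real base point *)

Section Conjugation.
Variables (m n : nat) (B : 'M[C]_(m, n)) (g s : R).
Hypotheses (g0 : 0 < g) (gB : good_gram B g s) (BB : conjmatrix B = B).

Let aB : accretive (sqrt_gram B) g. Proof. by case: gB. Qed.
Let SB := good_gram_conj gB BB.

Let cjE := (conjmatrixD, conjmatrixN, conjmatrixM, conjmatrix_tr, conjmatrix_inv).

Lemma polarC_conj : conjmatrix (polarC B) = polarC B.
Proof. by rewrite /polarC -/(sqrt_gram B) !cjE SB BB. Qed.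

Lemma sqrt_gram1_conj Z :
  conjmatrix (sqrt_gram1 B Z) = sqrt_gram1 B (conjmatrix Z).
Proof. by rewrite /sqrt_gram1 (lyapunov_inv_conj _ g0 aB SB) !cjE BB. Qed.

Lemma polarC1_conj Z : conjmatrix (polarC1 B Z) = polarC1 B (conjmatrix Z).
Proof.
rewrite /polarC1 conjmatrixM conjmatrixD conjmatrixN.
rewrite (conjmatrixM (polarC B)) conjmatrix_inv.
by rewrite sqrt_gram1_conj polarC_conj SB.
Qed.

Lemma polarC2_conj Z : conjmatrix (polarC2 B Z) = polarC2 B (conjmatrix Z).
Proof.
have S2 : conjmatrix (sqrt_gram2 B Z) = sqrt_gram2 B (conjmatrix Z).
  rewrite /sqrt_gram2 (lyapunov_inv_conj _ g0 aB SB) conjmatrixD conjmatrixN.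
  by rewrite (conjmatrixM (sqrt_gram1 B Z)) (conjmatrixM Z^T) conjmatrix_tr sqrt_gram1_conj.
rewrite /polarC2 conjmatrixM conjmatrixN conjmatrixD.
rewrite (conjmatrixM (polarC1 B Z)) (conjmatrixM (polarC B)) conjmatrix_inv.
by rewrite polarC1_conj S2 polarC_conj SB sqrt_gram1_conj.
Qed.

End Conjugation.

(** * Orders of magnitude of the Taylor terms *)

Section Orders.
Variables (m n : nat) (B : 'M[C]_(m, n)) (g s d : R).
Hypotheses (g0 : 0 < g) (gB : good_gram B g s) (d1 : d <= 1).

Let aB : accretive (sqrt_gram B) g. Proof. by case: gB. Qed.

Let ordbig_lyapunov (F : 'M[C]_(m, n) -> 'M[C]_n) k :
  ordbig d F k -> ordbig d (fun Z => lyapunov_inv (sqrt_gram B) (F Z)) k.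
Proof.
apply: (@ordbig_dom _ _ _ _ _ _ _ _ _ _ (2 * g)^-1) => [|Z _].
  by rewrite invr_ge0 mulr_ge0 // ltW.
exact: fro_lyapunov_inv g0 aB.
Qed.

Lemma ordbig_sqrt_gram1 : ordbig d (sqrt_gram1 B) 1.
Proof.
apply: ordbig_lyapunov; apply: ordbigD.
  exact: (ordbigM (ordbig_cst _ _ _ _) (ordbig_id _ _ _)).
exact: (ordbigM (ordbig_tr _ _ _) (ordbig_cst _ _ _ _)).
Qed.

Lemma ordbig_sqrt_gram2 : ordbig d (sqrt_gram2 B) 2.
Proof.
apply: ordbig_lyapunov; apply: ordbigD.
  exact: (ordbigM (ordbig_tr _ _ _) (ordbig_id _ _ _)).
exact/ordbigN/(ordbigM ordbig_sqrt_gram1 ordbig_sqrt_gram1).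
Qed.

Lemma ordbig_polarC1 : ordbig d (polarC1 B) 1.
Proof.
apply: (ordbigM (j := 1) (k := 0) _ (ordbig_cst _ _ _ _)).
apply: ordbigD; first exact: ordbig_id.
exact/ordbigN/(ordbigM (ordbig_cst _ _ _ _) ordbig_sqrt_gram1).
Qed.

Lemma ordbig_polarC2 : ordbig d (polarC2 B) 2.
Proof.
apply: (ordbigM (j := 2) (k := 0) _ (ordbig_cst _ _ _ _)).
apply/ordbigN/ordbigD; first exact: (ordbigM ordbig_polarC1 ordbig_sqrt_gram1).
exact: (ordbigM (ordbig_cst _ _ _ _) ordbig_sqrt_gram2).
Qed.

End Orders.

End Expansion.

(** * Third order remainder of the polar factor *)

Section PolarExpansion.
Variable R : realType.
Local Notation C := R[i].

(** With H = S1 + S2, the left side is S^2 - P^2 - S H - H P. Substituting S = D + P + H, the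
    equations for [S1] and [S2] cancel all terms of order one and two. *)
Lemma sqrt_remainder n (S P S1 S2 W Y : 'M[C]_n) :
  P *m S1 + S1 *m P = W -> P *m S2 + S2 *m P = Y - S1 *m S1 ->
  S *m S = P *m P + W + Y ->
  let D := S - (P + S1 + S2) in
  S *m D + D *m P
  = - (S1 *m S2 + S2 *m S1 + S2 *m S2) - D *m (S1 + S2).
Proof.
move/(canRL (addrK _)) => E1 /(canRL (addrK _)) E2 SS /=.
rewrite !(mulmxBl, mulmxBr, mulmxDl, mulmxDr, mulmxN, mulNmx) SS E1 E2.
(* With every product taken as an independent matrix, the identity is linear in the entries. *)
move: (S *m P) (S *m S1) (S *m S2) (S1 *m P) (S2 *m P) (P *m P).
move: (S1 *m S1) (S1 *m S2) (S2 *m S1) (S2 *m S2) (P *m S) (S1 *m S) (S2 *m S).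
by clear => *; apply/matrixP => i j; rewrite !mxE; ring.
Qed.

(** The same cancellation after multiplying the polar remainder by [S] on the right, which removes
    the inverse. *)
Lemma polar_remainder m n (B Z Q C1 C2 : 'M[C]_(m, n)) (S P S1 S2 : 'M[C]_n) :
  Q *m P = B -> C1 *m P = Z - Q *m S1 -> C2 *m P = - (C1 *m S1 + Q *m S2) ->
  B + Z - (Q + C1 + C2) *m S
  = - (C1 *m S2 + C2 *m S1 + C2 *m S2) - (Q + C1 + C2) *m (S - (P + S1 + S2)).
Proof.
move=> QP C1P C2P.
rewrite !(mulmxBr, mulmxDr, mulmxDl, mulmxN, mulNmx) QP C1P C2P.
move: (C1 *m S2) (C2 *m S1) (C2 *m S2) (Q *m S) (C1 *m S) (C2 *m S).
move: (Q *m S1) (Q *m S2) (C1 *m S1).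
by clear => *; apply/matrixP => i j; rewrite !mxE; ring.
Qed.

(** The Sylvester estimate bounds the square root remainder D by its third order source and by D (S1
    + S2), which is absorbed on a small ball. The polar remainder follows through the bound 1 / g on
    the inverse root. *)
Lemma polar_expansion m n (B : 'M[C]_(m, n)) (g s d : R) :
  0 < g -> 0 < d -> d <= 1 ->
  (forall Z, fro Z <= d -> good_gram (B + Z) g s) ->
  exists d', [/\ 0 < d', d' <= d &
    ordbig d' (fun Z => polarC (B + Z) - (polarC B + polarC1 B Z + polarC2 B Z)) 3].
Proof.
move=> g0 d0 d1 gBZ.
have gB : good_gram B g s by have := gBZ 0; rewrite fro0 addr0; apply; exact: ltW.
have [[PP _] _ aB _] := gB; have uB := accretive_unitmx g0 aB.
set P := sqrt_gram B in PP aB uB.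
pose S1 := sqrt_gram1 B; pose S2 := sqrt_gram2 B.
have oS1 : ordbig d S1 1 := ordbig_sqrt_gram1 d g0 gB.
have oS2 : ordbig d S2 2 := ordbig_sqrt_gram2 d g0 gB.
have oC1 : ordbig d (polarC1 B) 1 := ordbig_polarC1 d g0 gB.
have oC2 : ordbig d (polarC2 B) 2 := ordbig_polarC2 d g0 gB.
have oH : ordbig d (fun Z => S1 Z + S2 Z) 1.
  apply: (ordbigD oS1); exact: (@ordbigW _ _ _ _ _ _ _ 2 1 d1 isT oS2).
have oE : ordbig d (fun Z => S1 Z *m S2 Z + S2 Z *m S1 Z + S2 Z *m S2 Z) 3.
  apply: ordbigD; first by apply: ordbigD; [exact: (ordbigM oS1)|exact: (ordbigM oS2)].
  by apply: (ordbigW (j := 4)) => //; exact: (ordbigM oS2).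
(* On this radius |S1 + S2| <= g, so D (S1 + S2) uses up half of the lower bound 2 g |D|. *)
have [e [e0 ed He]] := ordbig_small d0 g0 oH.
pose D Z := sqrt_gram (B + Z) - (P + S1 Z + S2 Z).
have oD : ordbig e D 3.
  apply: (ordbig_dom (c := g^-1)) (ordbig_sub ed oE) => [|Z Ze].
    by rewrite invr_ge0 ltW.
  have [[SS _] _ aS _] := gBZ _ (le_trans Ze ed).
  rewrite ler_pdivlMl //.
  have := sylvester_lower (D Z) aS aB.
  set S := sqrt_gram (B + Z) in SS aS *.
  set E := _ + _ + _.
  have -> : S *m D Z + D Z *m P = - E - D Z *m (S1 Z + S2 Z).
    have E1 := lyapunov_invE (B^T *m Z + Z^T *m B) g0 aB.
    have E2 := lyapunov_invE (Z^T *m Z - S1 Z *m S1 Z) g0 aB.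
    apply: (sqrt_remainder E1 E2).
    by rewrite SS PP [(_ + _)^T]linearD /= mulmxDl !mulmxDr !addrA.
  have := ler_wpM2l (fro_ge0 (D Z)) (He Z Ze).
  have := froM (D Z) (S1 Z + S2 Z).
  have := froB (- E) (D Z *m (S1 Z + S2 Z)); rewrite froN.
  move: (fro (D Z)) (fro E) (fro (- E - _)) => x y z.
  move: (fro (D Z *m _)) (fro (S1 Z + S2 Z)) => u v; clear => h1 h2 h3 h4.
  have : x * v <= g * x by rewrite [g * x]mulrC.
  by move: (x * v) h2 {h3} => w h2 h3; lra.
exists e; split=> //.
have e1 := le_trans ed d1.
pose F Z := - (polarC1 B Z *m S2 Z + polarC2 B Z *m S1 Z + polarC2 B Z *m S2 Z)
  - (polarC B + polarC1 B Z + polarC2 B Z) *m D Z.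
have oF : ordbig e F 3.
  apply: ordbigD; apply: ordbigN.
    apply: (ordbig_sub ed).
    apply: ordbigD; first by apply: ordbigD; [exact: (ordbigM oC1)|exact: (ordbigM oC2)].
    by apply: (ordbigW (j := 4)) => //; exact: (ordbigM oC2).
  apply: (ordbigM (j := 0) (k := 3)) => //.
  apply: ordbigD; first apply: ordbigD.
  - exact: ordbig_cst.
  - by apply: (ordbigW (j := 1)) => //; exact: ordbig_sub oC1.
  - by apply: (ordbigW (j := 2)) => //; exact: ordbig_sub oC2.
apply: (ordbig_dom (c := g^-1)) oF => [|Z Ze]; first by rewrite invr_ge0 ltW.
have gZ := gBZ _ (le_trans Ze ed).
have [[SS _] _ aS _] := gZ.
have [QS _] := good_gram_polar g0 gZ.
have [QP _] := good_gram_polar g0 gB.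
have uS := accretive_unitmx g0 aS.
have -> : polarC (B + Z) - (polarC B + polarC1 B Z + polarC2 B Z)
    = F Z *m invmx (sqrt_gram (B + Z)).
  rewrite -[LHS](mulmxK uS) mulmxBl QS; congr (_ *m _).
  have C1P : polarC1 B Z *m P = Z - polarC B *m S1 Z by rewrite /polarC1 mulmxKV.
  have C2P : polarC2 B Z *m P = - (polarC1 B Z *m S1 Z + polarC B *m S2 Z).
    by rewrite /polarC2 mulmxKV.
  exact: polar_remainder.
apply: opbound_right; first by rewrite invr_ge0 ltW.
by apply: lower_inv => // p X; exact: accretive_lower.
Qed.

End PolarExpansion.

(** * Real matrices among complex ones, and Gram matrices near a real base point *)

Section RealMatrices.
Variable R : realType.
Local Notation C := R[i].

Lemma cplxM m n p (X : 'M[R]_(m, n)) (Y : 'M[R]_(n, p)) :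
  cplx (X *m Y) = cplx X *m cplx Y.
Proof. exact: (map_mxM (real_complex R)). Qed.

Lemma cplxD m n (X Y : 'M[R]_(m, n)) : cplx (X + Y) = cplx X + cplx Y.
Proof. exact: (map_mxD (real_complex R)). Qed.

Lemma cplxZ m n (a : R) (X : 'M[R]_(m, n)) : cplx (a *: X) = (a%:C)%C *: cplx X.
Proof. exact: (map_mxZ (real_complex R)). Qed.

Lemma cplx1 n : cplx (1%:M : 'M[R]_n) = 1%:M.
Proof. exact: (map_mx1 (real_complex R)). Qed.

Lemma cplx_tr m n (X : 'M[R]_(m, n)) : cplx X^T = (cplx X)^T.
Proof. by rewrite /cplx map_trmx. Qed.

Lemma cplxK m n : cancel (@cplx R m n) (@mxRe R m n).
Proof. by move=> X; apply/matrixP => i j; rewrite !mxE. Qed.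

Lemma mxIm_cplx m n (X : 'M[R]_(m, n)) : mxIm (cplx X) = 0.
Proof. by apply/matrixP => i j; rewrite !mxE. Qed.

Lemma conjmatrix_cplx m n (X : 'M[R]_(m, n)) : conjmatrix (cplx X) = cplx X.
Proof. by apply/matrixP => i j; rewrite !mxE /= oppr0. Qed.

Lemma cplx_mxRe m n (X : 'M[C]_(m, n)) : conjmatrix X = X -> cplx (mxRe X) = X.
Proof.
move=> XX; apply/matrixP => i j; rewrite !mxE.
have := congr1 (fun M : 'M[C]_(m, n) => M i j) XX; rewrite !mxE.
case: (X i j) => a b [] /eqP; rewrite eq_sym -subr_eq0 opprK -mulr2n.
by rewrite mulrn_eq0 /= => /eqP ->.
Qed.

Lemma mxReD m n (X Y : 'M[C]_(m, n)) : mxRe (X + Y) = mxRe X + mxRe Y.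
Proof.
by apply/matrixP => i j; rewrite !mxE; case: (X i j); case: (Y i j).
Qed.

Lemma mxImD m n (X Y : 'M[C]_(m, n)) : mxIm (X + Y) = mxIm X + mxIm Y.
Proof.
by apply/matrixP => i j; rewrite !mxE; case: (X i j); case: (Y i j).
Qed.

Lemma mxReN m n (X : 'M[C]_(m, n)) : mxRe (- X) = - mxRe X.
Proof. by apply/matrixP => i j; rewrite !mxE; case: (X i j). Qed.

Lemma mxImN m n (X : 'M[C]_(m, n)) : mxIm (- X) = - mxIm X.
Proof. by apply/matrixP => i j; rewrite !mxE; case: (X i j). Qed.

Lemma mxReZ m n (a : R) (X : 'M[C]_(m, n)) : mxRe ((a%:C)%C *: X) = a *: mxRe X.
Proof.
by apply/matrixP => i j; rewrite !mxE; case: (X i j) => b c /=; rewrite mul0r subr0.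
Qed.

Lemma mxRe_imag m n (h : R) (X : 'M[R]_(m, n)) : mxRe ((h *i)%C *: cplx X) = 0.
Proof. by apply/matrixP => i j; rewrite !mxE /= mul0r mulr0 subr0. Qed.

Lemma mxIm_imag m n (h : R) (X : 'M[R]_(m, n)) :
  mxIm ((h *i)%C *: cplx X) = h *: X.
Proof. by apply/matrixP => i j; rewrite !mxE /= mul0r add0r. Qed.

Lemma imag_sqr (h : R) : (h *i)%C * (h *i)%C = ((- h ^+ 2)%:C)%C.
Proof. by apply/eqP; rewrite eq_complex /= !mul0r !mulr0 addr0 sub0r !eqxx. Qed.

Lemma ip_ReIm m n (X Y : 'M[C]_(m, n)) :
  ip X Y = ip (cplx (mxRe X)) (cplx (mxRe Y)) + ip (cplx (mxIm X)) (cplx (mxIm Y)).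
Proof.
rewrite !ipE -big_split; apply: eq_bigr => i _; rewrite -big_split.
by apply: eq_bigr => j _; rewrite !mxE /= !mul0r !addr0.
Qed.

Lemma fro_cplx m n (X : 'M[R]_(m, n)) : fro (cplx X) = frob X.
Proof.
rewrite /fro /frob ipE; congr Num.sqrt; apply: eq_bigr => i _.
by apply: eq_bigr => j _; rewrite !mxE /= mul0r addr0 expr2.
Qed.

Lemma frob_mxRe m n (X : 'M[C]_(m, n)) : frob (mxRe X) <= fro X.
Proof.
by rewrite -fro_cplx ler_wsqrtr // (ip_ReIm X X) lerDl ip_ge0.
Qed.

Lemma frob_mxIm m n (X : 'M[C]_(m, n)) : frob (mxIm X) <= fro X.
Proof.
by rewrite -fro_cplx ler_wsqrtr // (ip_ReIm X X) lerDr ip_ge0.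
Qed.

Lemma adjmx_cplx m n (X : 'M[R]_(m, n)) : adjmx (cplx X) = (cplx X)^T.
Proof. by rewrite /adjmx conjmatrix_cplx. Qed.

Lemma ip_cplx m n (X Y : 'M[R]_(m, n)) : ip (cplx X) (cplx Y) = \tr (X^T *m Y).
Proof.
rewrite /ip adjmx_cplx -cplx_tr -cplxM /mxtrace Re_sum.
by apply: eq_bigr => i _; rewrite mxE.
Qed.

(** With d >= |B| and a left inverse of norm at most l, |X - d^-2 B^T B X|^2 <= |X|^2 - d^-2 |B X|^2
    <= (1 - d^-2 l^-2) |X|^2. Adding 1 to the norms keeps [d] and [l] positive. *)
Lemma gram_contraction m n (A : 'M[R]_(m, n)) : mxrank A = n ->
  exists k, 0 <= k < 1 /\
  opbound (1%:M - (((frob A + 1) ^- 2)%:C)%C *: ((cplx A)^T *m cplx A)) k.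
Proof.
move=> rA; have fA : row_full A by rewrite /row_full rA.
set B := cplx A; set d := frob A + 1; pose l := fro (cplx (pinvmx A)) + 1.
have LB : cplx (pinvmx A) *m B = 1%:M by rewrite -cplxM mulVpmx // cplx1.
have a0 : 0 <= frob A := sqrtr_ge0 _.
have d1 : 1 <= d by rewrite lerDr.
have l1 : 1 <= l by rewrite lerDr fro_ge0.
have d0 : 0 < d := lt_le_trans ltr01 d1.
have l0 : 0 < l := lt_le_trans ltr01 l1.
exists (Num.sqrt (1 - d ^- 2 * l ^- 2)); split.
  rewrite sqrtr_ge0 /= -[ltRHS]sqrtr1 ltr_sqrt // ltrBlDr ltrDl.
  by rewrite mulr_gt0 // invr_gt0 exprn_gt0.
move=> p X; apply: fro_le_sqrt.
have hB : fro X <= l * fro (B *m X).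
  rewrite -{1}[X]mul1mx -LB -mulmxA; apply: le_trans (froM _ _) _.
  by rewrite ler_wpM2r ?fro_ge0 // lerDl.
have hBB : fro (B^T *m (B *m X)) <= d * fro (B *m X).
  apply: le_trans (froM _ _) _; rewrite fro_tr fro_cplx.
  by rewrite ler_wpM2r ?fro_ge0 // lerDl.
have XU : ip X (B^T *m (B *m X)) = fro (B *m X) ^+ 2.
  by rewrite fro_sqr ip_adjl adjmx_cplx.
rewrite mulmxBl mul1mx -scalemxAl -mulmxA.
rewrite !(ipDl, ipDr, ipNl, ipNr, ipZl, ipZr) (ipC _ X) XU -!fro_sqr.
move: (fro_ge0 X) (fro_ge0 (B *m X)) (fro_ge0 (B^T *m (B *m X))) hB hBB.
move: (fro X) (fro (B *m X)) (fro (B^T *m _)) => x y z; clearbody l d.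
clear -d0 l0 => x0 y0 z0 hB hBB.
have w0 : 0 < d ^- 2 by rewrite invr_gt0 exprn_gt0.
have h1 : d ^- 2 * z ^+ 2 <= y ^+ 2.
  by rewrite ler_pdivrMl ?exprn_gt0 // -exprMn ler_pXn2r ?nnegrE ?mulr_ge0 // ltW.
have h2 : l ^- 2 * x ^+ 2 <= y ^+ 2.
  by rewrite ler_pdivrMl ?exprn_gt0 // -exprMn ler_pXn2r ?nnegrE ?mulr_ge0 // ltW.
have {}h1 := ler_wpM2l (ltW w0) h1; have {}h2 := ler_wpM2l (ltW w0) h2.
rewrite mulrBl mul1r -[in leRHS]mulrA; move: h1 h2.
move: (d ^- 2) (l ^- 2 * x ^+ 2) => u v h1 h2; lra.
Qed.

(** The perturbation of the scaled Gram matrix is allowed to consume half of the contraction margin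
    1 - k0. *)
Lemma gram_near m n (A : 'M[R]_(m, n)) : mxrank A = n ->
  exists g s d, [/\ 0 < g, 0 <= s, 0 < d <= 1 &
    forall Z, fro Z <= d -> good_gram (cplx A + Z) g s].
Proof.
move=> /gram_contraction[k0 [/andP[k00 k01] bK0]].
have a0 : 0 <= frob A := sqrtr_ge0 _.
set e := frob A + 1 in bK0; have e0 : 0 < e by rewrite ltr_wpDl.
set B := cplx A in bK0 *.
pose k := (1 + k0) / 2; have hk : 0 <= k < 1 by apply/andP; split; rewrite /k; lra.
exists (e * ((1 - k) / 2)), (2 * e), ((1 - k0) / 2); split.
- by rewrite mulr_gt0 // divr_gt0 // subr_gt0; case/andP: hk.
- by rewrite mulr_ge0 // ltW.
- by apply/andP; split; lra.
move=> Z Zd; pose W := B^T *m Z + Z^T *m B + Z^T *m Z.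
(* For z = |Z| <= 1 and a = |A|, 2 a z + z^2 <= (a + 1)^2 z. *)
have fW : fro W <= e ^+ 2 * ((1 - k0) / 2).
  have h1 := froM B^T Z; have h2 := froM Z^T B; have h3 := froM Z^T Z.
  have h4 := froD (B^T *m Z) (Z^T *m B).
  have h5 := froD (B^T *m Z + Z^T *m B) (Z^T *m Z).
  rewrite !fro_tr fro_cplx in h1 h2 h3.
  apply: le_trans (le_trans h5 (lerD (le_trans h4 (lerD h1 h2)) h3)) _.
  have z0 := fro_ge0 Z; move: (fro Z) z0 Zd => z z0 Zd.
  rewrite /e; move: (frob A) a0 => a a0; clear -z0 Zd a0 k00 k01; nra.
have bK : opbound (1%:M - ((e ^- 2)%:C)%C *: ((B + Z)^T *m (B + Z))) k.
  have -> : 1%:M - ((e ^- 2)%:C)%C *: ((B + Z)^T *m (B + Z))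
      = 1%:M - ((e ^- 2)%:C)%C *: (B^T *m B) - ((e ^- 2)%:C)%C *: W.
    rewrite -addrA -opprD -scalerDr; congr (_ - _ *: _).
    by rewrite [(B + Z)^T]linearD /= mulmxDl !mulmxDr /W !addrA.
  apply: (@opbound_le _ _ _ (k0 + (1 - k0) / 2)); first by rewrite /k; lra.
  apply: opboundD bK0 _; apply: opbound_le (opbound_fro _).
  rewrite froN froZr ?ler_pdivrMl ?exprn_gt0 //.
  by rewrite invr_ge0 exprn_ge0 // ltW.
have [S [hS aS bS]] := principal_sqrt_exists e0 hk bK.
rewrite /good_gram /sqrt_gram (principal_sqrtE hS); split=> //.
by apply: (principal_sqrt_tr hS); rewrite trmx_mul trmxK.
Qed.

(** The complex factor at a real point is real and provides a real polar decomposition. Conversely,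
    any real decomposition has as its [P] the principal root of the Gram matrix, hence the same
    [Q]. *)
Lemma polarRE m n (A : 'M[R]_(m, n)) g s : 0 < g -> good_gram (cplx A) g s ->
  cplx (polarR A) = polarC (cplx A).
Proof.
move=> g0 gA; have [QS QQ] := good_gram_polar g0 gA.
have [hS ST aS _] := gA; have BB := conjmatrix_cplx A.
have uS := accretive_unitmx g0 aS.
have QE := cplx_mxRe (polarC_conj gA BB).
have SE := cplx_mxRe (good_gram_conj gA BB).
set S := sqrt_gram (cplx A) in QS hS ST aS uS SE *.
have exQ : is_polar_factorR A (mxRe (polarC (cplx A))).
  split.
    by apply: (can_inj (@cplxK _ _)); rewrite cplxM cplx_tr QE QQ cplx1.
  exists (mxRe S); split; last split.
  - by apply: (can_inj (@cplxK _ _)); rewrite cplx_tr SE ST.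
  - move=> v v0; rewrite -trace_mx11 -mulmxA -ip_cplx cplxM SE.
    apply: lt_le_trans (aS _ (cplx v)); rewrite mulr_gt0 // -fro_sqr.
    rewrite exprn_gt0 // fro_gt0 //; apply: contra v0 => /eqP v0.
    by rewrite -(cplxK v) v0; apply/eqP/matrixP => i j; rewrite !mxE.
  - by apply: (can_inj (@cplxK _ _)); rewrite cplxM QE SE QS.
rewrite /polarR /pick_mx; case: pselect => [ex|[]]; last by eexists; exact: exQ.
case: (cid ex) => Q /= [Q1 [P [PT [Ppos AQP]]]].
have PS : cplx P = S.
  apply: (principal_sqrt_uniq _ hS); split.
    by rewrite -cplx_tr -!cplxM AQP trmx_mul PT -mulmxA (mulmxA Q^T) Q1 mul1mx.
  have pos (x : 'rV[R]_n) : x != 0 -> 0 < ip (cplx x) (cplx (x *m P)).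
    move=> x0; rewrite ip_cplx mxtrace_mulC trace_mx11.
    by have := Ppos x^T; rewrite trmxK; apply; rewrite trmx_eq0.
  have pos0 (x : 'rV[R]_n) : 0 <= ip (cplx x) (cplx (x *m P)).
    have [->|/pos/ltW//] := eqVneq x 0.
    by rewrite mul0mx ip_cplx mulmx0 mxtrace0.
  (* As [P] is real, the form splits over the real and imaginary parts of [v], at least one of which
     is nonzero. *)
  apply: pos_rhp_spectrum => v v0; rewrite ip_ReIm.
  have -> : mxRe (v *m cplx P) = mxRe v *m P.
    apply/matrixP => i j; rewrite !mxE Re_sum; apply: eq_bigr => l _.
    by rewrite !mxE; case: (v i l) => a b /=; rewrite mulr0 subr0.
  have -> : mxIm (v *m cplx P) = mxIm v *m P.
    apply/matrixP => i j; rewrite !mxE.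
    rewrite (big_morph (@complex.Im R) (id1 := 0) (op1 := +%R)) //; last first.
      by move=> [a b] [c d].
    apply: eq_bigr => l _.
    by rewrite !mxE; case: (v i l) => a b /=; rewrite mulr0 add0r.
  have [r0|r0] := eqVneq (mxRe v) 0; last by rewrite ltr_pwDl ?pos.
  have [i0|i0] := eqVneq (mxIm v) 0; last by rewrite ltr_wpDl ?pos.
  case/eqP: v0; apply/matrixP => i j.
  have := congr1 (fun M : 'rV[R]_n => M i j) r0.
  have := congr1 (fun M : 'rV[R]_n => M i j) i0.
  by rewrite !mxE; case: (v i j) => a b /= -> ->.
rewrite -[LHS](mulmxK uS) -[RHS](mulmxK uS) QS; congr (_ *m _).
by rewrite -PS -cplxM -AQP.
Qed.

End RealMatrices.

(** * Differentiability of the real polar factor *)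

Section Derivative.
Variable R : realType.
Local Notation C := R[i].

(** Limits and ['d] refer to the maximum norm on real matrices; this bound and the next pass between
    it and the Frobenius norm. *)
Lemma mx_norm_le_frob m n (X : 'M[R]_(m, n)) : `|X| <= frob X.
Proof.
rewrite [leLHS]/Num.norm /= mx_normrE; apply/bigmax_leP; split.
  exact: sqrtr_ge0.
move=> [i j] _ /=; rewrite -fro_cplx.
by apply: le_trans (Re_le_fro (cplx X) i j); rewrite mxE.
Qed.

Lemma frob_le_mx_norm m n (X : 'M[R]_(m, n)) :
  frob X <= ((m * n * 2)%:R + 1) * `|X|.
Proof.
rewrite -fro_cplx; apply: fro_le_entries => // i j.
rewrite !mxE /= normr0; split=> //.
rewrite [leRHS]/Num.norm /= mx_normrE.
by apply: (le_bigmax _ (fun ij => `|X ij.1 ij.2|) (i, j)).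
Qed.

Lemma geometric_cvg_mx m n (u : nat -> 'M[R]_(m, n)) l D q : 0 <= q < 1 ->
  (forall k, `|u k - l| <= D * q ^+ k) -> u @ \oo --> l.
Proof.
move=> /andP[q0 q1] h; apply/cvgrPdistC_le => e e0.
have c : (fun k : nat => D * q ^+ k) @ \oo --> D * 0.
  by apply: cvgMr; apply: cvg_expr; rewrite ger0_norm.
rewrite mulr0 in c; near=> k; apply: le_trans (h k) _.
apply: le_trans (ler_norm _) _; near: k.
exact: (cvgr0_norm_le _ c _ e0).
Unshelve. all: by end_near. Qed.

Definition dpolarR m n (A H : 'M[R]_(m, n)) : 'M[R]_(m, n) :=
  mxRe (polarC1 (cplx A) (cplx H)).

Lemma dpolarR_is_linear m n (A : 'M[R]_(m, n)) : linear (dpolarR A).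
Proof.
move=> a X Y; rewrite /dpolarR cplxD cplxZ polarC1_linear.
by rewrite mxReD mxReZ.
Qed.

HB.instance Definition _ m n (A : 'M[R]_(m, n)) :=
  GRing.isLinear.Build R 'M[R]_(m, n) 'M[R]_(m, n) _ (dpolarR A)
    (dpolarR_is_linear A).

(** For real increments the second and third order terms together are o(H), so the first order term
    is the differential by uniqueness. *)
Lemma diff_polarR m n (A : 'M[R]_(m, n)) g s d : 0 < g -> 0 < d -> d <= 1 ->
  (forall Z, fro Z <= d -> good_gram (cplx A + Z) g s) ->
  'd (@polarR R m n) A = dpolarR A :> ('M[R]_(m, n) -> 'M[R]_(m, n)).
Proof.
move=> g0 d0 d1 gAZ.
have gA : good_gram (cplx A) g s.
  by have := gAZ 0; rewrite fro0 addr0; apply; exact: ltW.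
set N : R := (m * n * 2)%:R + 1.
have N0 : 0 < N by rewrite ltr_wpDl.
have [d' [d'0 d'd [c3 c30 h3]]] := polar_expansion g0 d0 d1 gAZ.
have [c2 c20 h2] := ordbig_polarC2 1 g0 gA.
have [c1 c10 h1] := ordbig_polarC1 1 g0 gA.
apply: diff_unique.
  (* Continuity of the candidate follows from its first order bound near 0. *)
  apply/linear_bounded_continuous/ex_bound; exists c1.
  near=> H => /=; apply: le_trans (mx_norm_le_frob _) _.
  apply: le_trans (frob_mxRe _) _.
  have HN : `|H| <= N^-1.
    by near: H; apply: (cvgr0_norm_le id) => //; rewrite invr_gt0.
  have H1 : fro (cplx H) <= 1.
    rewrite fro_cplx; apply: le_trans (frob_le_mx_norm _) _.
    by rewrite -ler_pdivlMl // mulr1.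
  apply: le_trans (h1 _ H1) _.
  by rewrite -[leRHS]mulr1; apply: ler_wpM2l.
apply/eqaddoP => e e0.
(* The first bound keeps the increment in the ball of the expansion; the second turns (c2 + c3) N^2
   |H|^2 into at most e |H|. *)
pose r := Num.min (d' / N) (e / ((c2 + c3) * N ^+ 2 + 1)).
have r0 : 0 < r.
  by rewrite lt_min !divr_gt0 // ltr_wpDl // mulr_ge0 ?addr_ge0 // exprn_ge0 // ltW.
near=> H; have : `|H| <= r by near: H; exact: (cvgr0_norm_le id).
rewrite le_min => /andP[Hd He].
have zN : fro (cplx H) <= N * `|H| by rewrite fro_cplx frob_le_mx_norm.
have zd' : fro (cplx H) <= d'.
  by apply: le_trans zN _; rewrite mulrC -ler_pdivlMr.
have zd := le_trans zd' d'd; have z1 := le_trans zd d1.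
have gH := gAZ _ zd.
have -> : (polarR (m := m) (n := n) \o shift A - (cst (polarR A) + dpolarR A)) H
    = mxRe (polarC (cplx A + cplx H)
            - (polarC (cplx A) + polarC1 (cplx A) (cplx H))).
  rewrite [LHS]/(polarR (H + A) - (polarR A + dpolarR A H)).
  have -> : polarR (H + A) = mxRe (polarC (cplx A + cplx H)).
    by rewrite -cplxD in gH *; rewrite -(polarRE g0 gH) cplxK; congr polarR; exact: addrC.
  by rewrite mxReD mxReN mxReD -(polarRE g0 gA) cplxK.
apply: le_trans (mx_norm_le_frob _) _; apply: le_trans (frob_mxRe _) _.
have -> : polarC (cplx A + cplx H) - (polarC (cplx A) + polarC1 (cplx A) (cplx H))
   = (polarC (cplx A + cplx H) - (polarC (cplx A) + polarC1 (cplx A) (cplx H)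
      + polarC2 (cplx A) (cplx H))) + polarC2 (cplx A) (cplx H).
  by rewrite [in RHS]opprD addrA subrK.
apply: le_trans (froD _ _) _.
apply: le_trans (lerD (h3 _ zd') (h2 _ z1)) _.
have z0 := fro_ge0 (cplx H); move: (fro _) z0 zN z1 {zd zd'} => z z0 zN z1.
have H0 := normr_ge0 H.
move: `|H| H0 zN He {Hd} => t t0 zN He; clear -c20 c30 N0 e0 z0 zN z1 t0 He.
apply: (@le_trans _ _ ((c2 + c3) * z ^+ 2)).
  rewrite mulrDl addrC lerD2l; apply: ler_wpM2l => //.
  by rewrite ler_wiXn2l.
apply: (@le_trans _ _ ((c2 + c3) * (N * t) ^+ 2)).
  apply: ler_wpM2l; first exact: addr_ge0.
  by rewrite ler_pXn2r // nnegrE // mulr_ge0 // ltW.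
have k0 : 0 <= (c2 + c3) * N ^+ 2 by rewrite mulr_ge0 ?addr_ge0 // exprn_ge0 // ltW.
rewrite exprMn mulrA [t ^+ 2]expr2 mulrA; apply: ler_wpM2r => //.
move: He; rewrite ler_pdivlMr ?ltr_wpDl //; move: (_ * N ^+ 2) k0 => k k0; lra.
Unshelve. all: by end_near. Qed.

End Derivative.

(** * The complex step: limits of the iterates and both error bounds *)

Lemma fro_imag (R : realType) m n (h : R) (E : 'M[R]_(m, n)) : 0 <= h ->
  fro ((h *i)%C *: cplx E) = h * frob E.
Proof.
move=> h0; rewrite froZ fro_cplx /= expr0n /= add0r sqrtr_sqr.
by rewrite ger0_norm.
Qed.

Theorem theorem2 (R : realType) (m n : nat) (A E : 'M[R]_(m, n)) :
  (n <= m)%N -> mxrank A = n ->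
  exists h0 : R, 0 < h0 /\ exists C : R,
    forall h : R, 0 < h -> h < h0 ->
      (forall k : nat, mxrank (newton_iter (cstep A E h) k) = n) /\
      (fun k => mxRe (newton_iter (cstep A E h) k)) @ \oo
         --> mxRe (polarC (cstep A E h)) /\
      (fun k => h^-1 *: mxIm (newton_iter (cstep A E h) k)) @ \oo
         --> h^-1 *: mxIm (polarC (cstep A E h)) /\
      frob (mxRe (polarC (cstep A E h)) - polarR A) <= C * h ^+ 2 /\
      frob (h^-1 *: mxIm (polarC (cstep A E h)) - 'd (@polarR R m n) A E)
         <= C * h ^+ 2.
Proof.
move=> _ rA; have [g [s [d [g0 s0 /andP[d0 d1] gAZ]]]] := gram_near rA.
have gA : good_gram (cplx A) g s.
  by have := gAZ 0; rewrite fro0 addr0; apply; exact: ltW.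
have [d' [d'0 d'd [c3 c30 h3]]] := polar_expansion g0 d0 d1 gAZ.
have [c2 c20 h2] := ordbig_polarC2 1 g0 gA.
set e := frob E; have e0 : 0 <= e := sqrtr_ge0 _.
have e1 : 0 < e + 1 by rewrite ltr_wpDl.
(* Ensures h |E| <= d', also when [E] is zero. *)
exists (d' / (e + 1)); split; first by rewrite divr_gt0.
(* The sum of the constants of the real and imaginary estimates. *)
exists ((c2 + c3) * e ^+ 2 + c3 * e ^+ 3) => h hp; rewrite ltr_pdivlMr // => hd.
rewrite /cstep; set Z := (h *i)%C *: cplx E.
have fZ : fro Z = h * e by rewrite fro_imag // ltW.
have Zd' : fro Z <= d'.
  by rewrite fZ; apply: le_trans (ltW hd); rewrite ler_pM2l // lerDl.
have Zd := le_trans Zd' d'd; have Z1 := le_trans Zd d1.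
have gZ := gAZ _ Zd; have [QS QQ] := good_gram_polar g0 gZ.
have [_ ST aS bS] := gZ.
have [D [q [q01 rk cv]]] := newton_iter_cvg g0 s0 QQ ST aS bS.
(* The starting point A + ihE is itself Q S, so the convergence result applies to it. *)
rewrite QS in rk cv; set Q := polarC (cplx A + Z) in cv *.
set X := newton_iter _ in rk cv *.
have BB := conjmatrix_cplx A.
set F := Q - (polarC (cplx A) + polarC1 (cplx A) Z + polarC2 (cplx A) Z).
have hF : fro F <= c3 * (h * e) ^+ 3 by rewrite -fZ; exact: h3.
have hC2 : fro (polarC2 (cplx A) Z) <= c2 * (h * e) ^+ 2 by rewrite -fZ; exact: h2.
have he1 : h * e <= 1 by rewrite -fZ.
have he0 : 0 <= h * e by rewrite mulr_ge0 // ltW.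
have C1E : polarC1 (cplx A) Z = (h *i)%C *: cplx (dpolarR A E).
  rewrite polarC1Z cplx_mxRe // (polarC1_conj g0 gA BB).
  by rewrite conjmatrix_cplx.
have C2E : polarC2 (cplx A) Z
    = ((- h ^+ 2)%:C)%C *: cplx (mxRe (polarC2 (cplx A) (cplx E))).
  rewrite polarC2Z imag_sqr cplx_mxRe // (polarC2_conj g0 gA BB).
  by rewrite conjmatrix_cplx.
have QE : Q = F + polarC2 (cplx A) Z + polarC1 (cplx A) Z + cplx (polarR A).
  rewrite (polarRE g0 gA) /F opprD addrA subrK opprD addrA.
  by rewrite subrK subrK.
split=> //; split; last split; last split.
- apply: (geometric_cvg_mx q01 (D := D)) => k; apply: le_trans (cv k).
  rewrite -mxReN -mxReD.
  exact: le_trans (mx_norm_le_frob _) (frob_mxRe _).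
- apply: (geometric_cvg_mx q01 (D := h^-1 * D)) => k.
  rewrite -scalerBr normrZ gtr0_norm ?invr_gt0 // -mulrA.
  apply: ler_wpM2l; first by rewrite invr_ge0 ltW.
  apply: le_trans (cv k); rewrite -mxImN -mxImD.
  exact: le_trans (mx_norm_le_frob _) (frob_mxIm _).
(* The first order term is purely imaginary, so the real error starts at order two. *)
- have -> : mxRe Q - polarR A = mxRe (F + polarC2 (cplx A) Z).
    by rewrite QE !mxReD C1E mxRe_imag addr0 cplxK addrK.
  apply: le_trans (frob_mxRe _) _; apply: le_trans (froD _ _) _.
  apply: le_trans (lerD hF hC2) _.
  apply: (@le_trans _ _ ((c2 + c3) * (h * e) ^+ 2)).
    rewrite mulrDl addrC lerD2l; apply: ler_wpM2l => //.
    by rewrite ler_wiXn2l.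
  rewrite exprMn [h ^+ 2 * _]mulrC mulrA; apply: ler_wpM2r.
    by rewrite exprn_ge0 // ltW.
  by rewrite lerDl mulr_ge0 // exprn_ge0.
(* The terms of order zero and two are real; only the third order remainder divided by [h] is
   left. *)
have -> : h^-1 *: mxIm Q - 'd (@polarR R m n) A E = h^-1 *: mxIm F.
  rewrite (diff_polarR g0 d0 d1 gAZ) QE !mxImD C2E C1E mxIm_imag mxIm_cplx.
  have -> : mxIm (((- h ^+ 2)%:C)%C *: cplx (mxRe (polarC2 (cplx A) (cplx E)))) = 0.
    by rewrite -cplxZ mxIm_cplx.
  by rewrite !addr0 scalerDr scalerA mulVf ?gt_eqF // scale1r addrK.
have hi : 0 <= h^-1 by rewrite invr_ge0 ltW.
rewrite -fro_cplx cplxZ froZr // fro_cplx.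
apply: le_trans (ler_wpM2l hi (le_trans (frob_mxIm _) hF)) _.
have -> : h^-1 * (c3 * (h * e) ^+ 3) = c3 * e ^+ 3 * h ^+ 2.
  by field; rewrite gt_eqF.
apply: ler_wpM2r; first by rewrite exprn_ge0 // ltW.
by rewrite lerDr mulr_ge0 ?addr_ge0 // exprn_ge0.
Qed.
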